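(* Fix an integer $k\ge1$. Let $q\in[1,k]$ and $j\in[1,q]$ be integers with $\gcd(j,q)=1$, and let $f,m,M,s,t,\eta,c$ be as defined in the context. Then for each $w\in[1,f]$, $c(0)\to c(1)\to\cdots\to c(q)=c(0)$ is a cycle of $G(\eta(q,j),k)$, and these $f$ cycles (for $w=1,\dots,f$) are distinct cycles of length $q$; consequently $N(\eta(q,j),k)=f$ and $\eta(q,j)$ is a local peak. Moreover, the local peaks are exactly the integers $\eta(q,j)$ with $1\le q\le k$, $1\le j\le q$, $\gcd(j,q)=1$; i.e. the set of points $(n,N(n,k))$ with $n$ a local peak is exactly $\{(\eta(q,j),\lfloor k/q\rfloor): 1\le q\le k,\ 1\le j\le q,\ \gcd(j,q)=1\}$.
   Context: For integers $\ell$ and $p\ge1$, $(\ell)_p$ (also $\ell_p$) denotes the least nonnegative residue of $\ell$ modulo $p$. $G(n,k)$ is the directed graph on vertices $0,\dots,k$ with exactly the $k$ edges $(i+n-2)_{k+1}\to(i+n-1)_k$, $1\le i\le k$ (a loop $a\to a$ counts as a cycle of length $1$). For $n>k$, $N(n,k)$ is the nullity of the $n\times n$ skew-symmetric Toeplitz matrix $A(n,k)$ whose first $k$ superdiagonals are all $1$ and remaining superdiagonals all $0$; this nullity depends only on $n \bmod (k^2+k)$, and $N(n,k)$ is defined for every integer $n$ as $N(n',k)$ for any $n'>k$ with $n'\equiv n\pmod{k^2+k}$. An integer $n$ with $0<n<k^2+k$ is a local peak if $N(n-1,k)<N(n,k)$ and $N(n+1,k)<N(n,k)$. Notation: $f=\lfloor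 k/q\rfloor$, $m=k-fq$, $M=m+1$; $s(q,j)=|\{a\in[1,m]:(aj)_q\le(Mj)_q\}|$; for $r\in[1,q-1]$, $t(r,q,j)=|\{a\in[0,m]:(aj)_q<(rj)_q\}|$; $\eta(q,j)=k\lfloor (k+1)j/q\rfloor-k+(Mj)_q f+s(q,j)$; for $w\in[1,f]$, $c(r)=-1-w+(rj)_q f+t(r,q,j)$ for $1\le r\le q-1$ and $c(0)=c(q)=k-w$. *)

(* Defs.v *)
From HB Require Import structures.
From mathcomp Require Import all_boot all_order all_algebra.
Set Implicit Arguments. Unset Strict Implicit. Unset Printing Implicit Defensive.
Import Order.TTheory GRing.Theory Num.Theory.

Local Open Scope ring_scope.

Definition res (l : int) (p : nat) : int := (l %% (p%:Z))%Z.

(* G(n,k): vertices 0..k, edges (i+n-2)_{k+1} -> (i+n-1)_k for 1 <= i <= k. *)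
Definition Gedge (n : int) (k : nat) (a b : int) : Prop :=
  exists i : nat, (1 <= i <= k)%N /\
    a = res (i%:Z + n - 2) k.+1 /\ b = res (i%:Z + n - 1) k.

Definition Amat (n k : nat) : 'M[rat]_n :=
  \matrix_(i < n, j < n)
    (if (i < j <= i + k)%N then 1
     else if (j < i <= j + k)%N then -1 else 0).

Definition Nnat (n k : nat) : nat := (n - \rank (Amat n k))%N.

(* N(n,k) for an arbitrary integer n: nullity of A(n',k) with n' > k,
   n' = n mod (k^2+k); we take n' = (n mod (k^2+k)) + (k^2+k). *)
Definition Nk (n : int) (k : nat) : nat :=
  Nnat (`|(n %% ((k ^ 2 + k)%N)%:Z)%Z|%N + (k ^ 2 + k))%N k.

Definition local_peak (k : nat) (n : int) : Prop :=
  0 < n < ((k ^ 2 + k)%N)%:Z /\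
  (Nk (n - 1) k < Nk n k)%N /\ (Nk (n + 1) k < Nk n k)%N.

Definition fq (k q : nat) : nat := (k %/ q)%N.
Definition mq (k q : nat) : nat := (k - fq k q * q)%N.
Definition Mq (k q : nat) : nat := (mq k q).+1.

Definition sq (k q j : nat) : nat :=
  count (fun a => (a * j %% q <= Mq k q * j %% q)%N) (iota 1 (mq k q)).
Definition tq (k q j r : nat) : nat :=
  count (fun a => (a * j %% q < r * j %% q)%N) (iota 0 (mq k q).+1).

Definition etaq (k q j : nat) : int :=
  (k%:Z * ((((k + 1) * j) %/ q)%N)%:Z - k%:Z
   + ((Mq k q * j %% q) * fq k q)%N%:Z + (sq k q j)%:Z).

Definition cyc (k q j w r : nat) : int :=
  if (r == 0%N) || (r == q) then k%:Z - w%:Z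
  else -1 - w%:Z + ((r * j %% q) * fq k q)%N%:Z + (tq k q j r)%:Z.

(* Main.v *)
Require Import Defs.
From HB Require Import structures.
From mathcomp Require Import all_boot all_order all_algebra all_fingroup.
From mathcomp Require Import zify ring.
Import Order.TTheory GRing.Theory Num.Theory.
Local Open Scope ring_scope.

(** A vector [x] is in the kernel of [A(n,k)] iff its generating polynomial times
    [P = (1 + ... + X^(k-1)) (1 - X^(k+1))] has the form [u + X^(n+k) v] with [u], [v]
    of degree less than [k].  Since [P] is the lcm of [X^k - 1] and [X^(k+1) - 1] up
    to sign, this says that [u] is constant along the edges of [G(n,k)] and vanishes
    on the path from [k] to the vertex without outgoing edge.  Closing this path into
    a cycle turns [G(n,k)] into a permutation with [N(n,k) + 1] cycles.

    Up to conjugation, passing from [n] to [n + 1] multiplies this permutation by the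
    transposition [(k-1 k)], and passing from [n] to [n - 1] by [(0 k)].  Hence [N]
    changes by exactly one at each step, it decreases from [n] to [n + 1] iff [k - 1]
    lies on a cycle of [G(n,k)], and from [n] to [n - 1] iff [0] does.  The cycle
    [c_w] of [G(eta,k)] survives in [G(eta + h,k)] for [1 - w <= h <= f - w]; as [c_1]
    contains [k - 1] and [c_f] contains [0], [N] falls [f] times in a row on both sides
    of [eta].

    The up-steps [eta(q,j) - i], [1 <= i <= f], are pairwise distinct modulo
    [k^2 + k], and the triples [(q,j,i)] correspond to the pairs [1 <= a <= b <= k]
    via [(a,b) = (j i, q i)], so there are [k (k+1) / 2] of them.  This is half of the
    period, which is the total number of up-steps; hence there are no further peaks.
    Finally [N(k^2) = k], [eta(1,1) = k^2], and following [N] step by step shows that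
    every run of descents ends at [0], whence [N(eta(q,j)) = f]. *)

(** * The cycles of G(eta(q,j),k) *)

(* The vertices [0..k] fall into [q] consecutive blocks, each met once by every cycle
   [c_w].  The block of [c_w(r)] has number [(r j)_q], where [0] is read as [q]. *)
Definition slot (q j r : nat) : nat :=
  if (r == 0)%N || (r == q) then q else (r * j %% q)%N.

Definition below (q j m x : nat) : nat :=
  count (fun a => a * j %% q < x)%N (iota 1 m).

Lemma divmod_add (x j q : nat) : (j <= q)%N -> (0 < q)%N ->
  ((x + j) %/ q = x %/ q + (q <= x %% q + j) /\
   (x + j) %% q + (q <= x %% q + j) * q = x %% q + j)%N.
Proof.
move=> jq q0; have lt := ltn_pmod x q0.
have E : (x + j = (x %/ q + (q <= x %% q + j)) * q
                  + (x %% q + j - (q <= x %% q + j) * q))%N.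
  by rewrite {1}(divn_eq x q); case: leqP => /=; lia.
have small : (x %% q + j - (q <= x %% q + j) * q < q)%N.
  by case: leqP => /=; lia.
rewrite E divnMDl // modnMDl (divn_small small) (modn_small small) addn0.
by split => //; case: leqP => /=; lia.
Qed.

Lemma below_recr (q j m x : nat) :
  below q j m.+1 x = (below q j m x + (m.+1 * j %% q < x))%N.
Proof.
have E : iota 1 m.+1 = iota 1 m ++ [:: m.+1] by rewrite -{1}[m.+1]addn1 iotaD.
by rewrite /below E count_cat /= addn0.
Qed.

(** Walking around [Z/q] from [0] in steps of [j], each turn meets the window [[v, v + j)] once. The
    walk has begun [m * j %/ q + 1] turns, and the term [m * j %% q < v] accounts for a last turn
    that has not yet reached the window. *)
Lemma below_shift (q j m v : nat) : (0 < q)%N -> (j <= q)%N -> (0 < v)%N ->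
  (v + j <= q)%N ->
  (below q j m (v + j) + (m * j %% q < v) = below q j m v + m * j %/ q + 1)%N.
Proof.
move=> q0 jq v0 vj; elim: m => [|m IH].
  by rewrite /below /= mul0n mod0n div0n v0.
have [Ed Em] := @divmod_add (m * j) j q jq q0.
have lt := ltn_pmod (m * j) q0.
rewrite !below_recr mulSn addnC -(addnC (m * j)%N) Ed; move: IH Em.
by case: (leqP q (m * j %% q + j)) => /=; lia.
Qed.

(** The same turn count for the window [[v, q)] continued by [[0, v + j - q)]. *)
Lemma below_shift_wrap (q j m v : nat) : (0 < q)%N -> (j <= q)%N ->
  (v <= q)%N -> (q < v + j)%N ->
  (below q j m (v + j - q) + m + (m * j %% q < v)
   = below q j m v + m * j %/ q + 1)%N.
Proof.
move=> q0 jq vq vj; elim: m => [|m IH].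
  by rewrite /below /= mul0n mod0n div0n; lia.
have [Ed Em] := @divmod_add (m * j) j q jq q0.
have lt := ltn_pmod (m * j) q0.
rewrite !below_recr mulSn -(addnC (m * j)%N) Ed; move: IH Em.
by case: (leqP q (m * j %% q + j)) => /=; lia.
Qed.

Lemma below_le (q j m x y : nat) : (x <= y)%N -> (below q j m x <= below q j m y)%N.
Proof. by move=> xy; apply: sub_count => a /= /leq_trans; apply. Qed.

Lemma below_size (q j m x : nat) : (below q j m x <= m)%N.
Proof. by rewrite /below (leq_trans (count_size _ _)) ?size_iota. Qed.

Lemma below_full (q j m : nat) : (0 < q)%N -> below q j m q = m.
Proof.
move=> q0; rewrite /below -[RHS](size_iota 1) (eq_count (a2 := predT)).
  exact: count_predT.
by move=> a /=; rewrite ltn_pmod.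
Qed.

Lemma k_eq (k q : nat) : (k = fq k q * q + mq k q)%N.
Proof. by rewrite /mq /fq subnKC // leq_trunc_div. Qed.

Lemma mq_lt (k q : nat) : (0 < q)%N -> (mq k q < q)%N.
Proof. by move=> q0; rewrite /mq /fq; have := ltn_pmod k q0; have := divn_eq k q; lia. Qed.

Lemma modn_coprime_inj (q j r r' : nat) : coprime j q -> (r < q)%N -> (r' < q)%N ->
  (r * j %% q = r' * j %% q -> r = r')%N.
Proof.
move=> cjq; wlog le : r r' / (r <= r')%N.
  by case/orP: (leq_total r r') => le H l l' E; [|symmetry]; apply: H.
move=> _ lt' /esym/eqP; rewrite eqn_mod_dvd ?leq_mul2r ?le ?orbT // -mulnBl.
rewrite Gauss_dvdl 1?coprime_sym // => /dvdnP[[|c]]; nia.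
Qed.

Lemma slot_bounds (q j r : nat) : (0 < q)%N -> coprime j q -> (r <= q)%N ->
  (0 < slot q j r <= q)%N.
Proof.
move=> q0 cjq rq; rewrite /slot; case: (r =P 0%N) => [|r0] /=; first by rewrite q0 /=.
case: (r =P q) => [|rq'] /=; first by rewrite q0 /=.
rewrite (ltnW (ltn_pmod _ q0)) andbT lt0n; apply/eqP => E.
by apply: r0; apply: (@modn_coprime_inj q j) => //; [lia|rewrite E mod0n].
Qed.

Lemma slot_mod (q j r : nat) : slot q j r = r * j %[mod q].
Proof.
rewrite /slot; case: (r =P 0%N) => [->|_] /=; first by rewrite modnn mul0n mod0n.
by case: (r =P q) => [->|_] /=; rewrite ?modn_mod // modnn modnMr.
Qed.

Lemma slot_inj (q j r r' : nat) : coprime j q -> (r < q)%N -> (r' < q)%N ->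
  slot q j r = slot q j r' -> r = r'.
Proof.
move=> cjq lt lt' E; apply: (@modn_coprime_inj q j) => //.
by rewrite -!slot_mod E.
Qed.

Lemma mod_rep_inj (q x y : nat) : (0 < x <= q)%N -> (0 < y <= q)%N ->
  x = y %[mod q] -> x = y.
Proof.
move=> bx bY; wlog le : x y bx bY / (x <= y)%N.
  by case/orP: (leq_total x y) => le H E; [|symmetry]; apply: H.
by move/esym/eqP; rewrite eqn_mod_dvd // => /dvdnP[[|c]]; nia.
Qed.

Lemma slotS (q j r : nat) : (0 < j <= q)%N -> coprime j q -> (r < q)%N ->
  slot q j r.+1 =
    (if slot q j r + j <= q then slot q j r + j else slot q j r + j - q)%N.
Proof.
move=> /andP[j0 jq] cjq rq; have q0 : (0 < q)%N by lia.
have b := @slot_bounds q j r q0 cjq (ltnW rq).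
have b' := @slot_bounds q j r.+1 q0 cjq rq.
have : slot q j r.+1 = slot q j r + j %[mod q].
  by rewrite slot_mod -modnDml slot_mod modnDml mulSn addnC.
set u := slot q j r.+1 in b' *; set v := slot q j r in b *.
case: leqP => vj E; apply: (@mod_rep_inj q) => //; try lia.
by rewrite E -[in LHS](subnK (ltnW vj)) modnDr.
Qed.

(** The term [a = 0] counted by [tq] cancels the [-1] in [cyc], and at slot [q] the formula gives
    [f q + m = k]; so both branches of [cyc] merge. *)
Lemma cycE (k q j w r : nat) : (0 < q)%N -> coprime j q -> (r <= q)%N ->
  cyc k q j w r =
    (fq k q * slot q j r + below q j (mq k q) (slot q j r))%N%:Z - w%:Z.
Proof.
move=> q0 cjq rq; have := @slot_bounds q j r q0 cjq rq.
rewrite /cyc /slot; case: ifP => [_ _|_ /andP[s0 _]].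
  by rewrite below_full // -k_eq.
rewrite /tq /= -/(below q j (mq k q) (r * j %% q)) mul0n mod0n s0; lia.
Qed.

(** For fixed [v] the values fill the [f] integers just under [f * v + below q j m v]; since [below]
    is monotone in its bound, these intervals are disjoint for different [v]. *)
Lemma block_inj (f q j m v v' w w' : nat) : (0 < w <= f)%N -> (0 < w' <= f)%N ->
  (f * v + below q j m v)%N%:Z - w%:Z = (f * v' + below q j m v')%N%:Z - w'%:Z ->
  v = v' /\ w = w'.
Proof.
move=> hw hw' E; suff vv : v = v' by split => //; move: E; rewrite vv; lia.
wlog lt : v v' w w' hw hw' E / (v < v')%N => [H|].
  case: (ltngtP v v') => // lt; first exact: (H v v' w w' hw hw' E lt).
  by rewrite (H v' v w' w hw' hw (esym E) lt).
by have := @below_le q j m v v' (ltnW lt); nia.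
Qed.

(** For [1 <= a <= m] one has [0 < M - a < q], so [a j] and [M j] differ modulo [q] and the weak
    inequality in [sq] is strict. *)
Lemma sqE (k q j : nat) : (0 < q)%N -> coprime j q ->
  sq k q j = below q j (mq k q) (Mq k q * j %% q).
Proof.
move=> q0 cjq; apply: eq_in_count => a; rewrite mem_iota /Mq => /andP[a1 am].
rewrite leq_eqVlt; case: eqP => //= E; exfalso.
have mlt := @mq_lt k q q0.
have : (0 * j %% q = ((mq k q).+1 - a) * j %% q)%N.
  by apply/eqP; rewrite mul0n mod0n eq_sym -/(dvdn _ _) mulnBl -eqn_mod_dvd ?E // leq_mul2r; lia.
move/(@modn_coprime_inj q j 0 _ cjq); lia.
Qed.

Lemma res_eq (x y z : int) (p : nat) : 0 <= x < p%:Z -> y = x + p%:Z * z ->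
  x = res y p.
Proof.
move=> /andP[x0 xp] ->; rewrite /res addrC mulrC modzMDl modz_small //.
by rewrite x0 /=; lia.
Qed.

Lemma cyc_range (k q j w r : nat) : (0 < q)%N -> coprime j q -> (r <= q)%N ->
  (0 < w <= fq k q)%N -> 0 <= cyc k q j w r < k%:Z.
Proof.
move=> q0 cjq rq hw; rewrite cycE //.
have := @slot_bounds q j r q0 cjq rq; have := @below_size q j (mq k q) (slot q j r).
by move: (k_eq k q); nia.
Qed.

(* The margin left by the bounds on [i] is what makes the cycle persist in the
   neighbouring graphs [G(eta + h, k)]. *)
Lemma cyc_edge (k q j w r : nat) :
  (1 <= q <= k)%N -> (1 <= j <= q)%N -> coprime j q -> (1 <= w <= fq k q)%N ->
  (r < q)%N ->
  exists2 i : int, (fq k q)%:Z - w%:Z + 1 <= i <= k%:Z - w%:Z + 1 &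
    cyc k q j w r = res (i + etaq k q j - 2) k.+1 /\
    cyc k q j w r.+1 = res (i + etaq k q j - 1) k.
Proof.
move=> /andP[q0 qk] /andP[j0 jq] cjq hw rq.
have R0 := @cyc_range k q j w r q0 cjq (ltnW rq) hw.
have R1 := @cyc_range k q j w r.+1 q0 cjq rq hw.
have bv := @slot_bounds q j r q0 cjq (ltnW rq).
have bv' := @slot_bounds q j r.+1 q0 cjq rq.
have vS := @slotS q j r (introT andP (conj j0 jq)) cjq rq.
have c0 := @cycE k q j w r q0 cjq (ltnW rq).
have c1 := @cycE k q j w r.+1 q0 cjq rq.
set v := slot q j r in bv vS c0; set v' := slot q j r.+1 in bv' vS c1.
set f := fq k q in hw c0 c1 *; set m := mq k q in c0 c1.
set p := (m * j %% q)%N.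
have kE : (k = f * q + m)%N := k_eq k q.
have mlt : (m < q)%N := @mq_lt k q q0.
have [Ed Em] := @divmod_add (m * j) j q jq q0.
rewrite -/p in Ed Em.
have plt : (p < q)%N := ltn_pmod _ q0.
set W1 := (q <= p + j)%N in Ed Em.
have etaE : etaq k q j = k%:Z * (f * j + m * j %/ q + W1)%N%:Z - k%:Z
   + ((m * j + j) %% q * f)%N%:Z + (below q j m ((m * j + j) %% q))%:Z.
  rewrite /etaq sqE // /Mq -/m -/f mulSn (addnC j).
  have -> : ((k + 1) * j = f * j * q + (m * j + j))%N.
    by rewrite {1}kE; lia.
  by rewrite divnMDl // Ed addnA.
have shift : (below q j m v' + (q < v + j) * m + (p < v)
              = below q j m v + m * j %/ q + 1)%N.
  rewrite vS; case: leqP => vj /=.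
    by rewrite mul0n addn0 below_shift //; lia.
  by rewrite mul1n below_shift_wrap //; lia.
set rho := ((m * j + j) %% q)%N in Em etaE.
have rlt : (rho < q)%N := ltn_pmod _ q0.
set F := (f * j + m * j %/ q)%N in etaE.
have le1 := @below_size q j m v'; have le2 := @below_size q j m rho.
have mon : (if rho < v' then below q j m rho <= below q j m v'
            else below q j m v' <= below q j m rho)%N.
  by case: ltnP => h; apply: below_le => //; apply: ltnW.
have fv : (f * v' + (q < v + j) * (f * q) = f * v + f * j)%N.
  rewrite -mulnDr vS; case: leqP => vj /=; first by rewrite mul0n addn0.
  by rewrite mul1n -mulnDr subnK // ltnW.
have step : (cyc k q j w r.+1 = cyc k q j w r + F%:Z + 1 - (p < v)%N%:Z
    - k%:Z * (q < v + j)%N%:Z)%R.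
  by rewrite c0 c1 /F; move: shift fv kE; case: (ltnP q (v + j)) => /= _; lia.
set wr := (q < v + j)%N in step.
(* Shifting [p] and [v] by [j] to [rho] and [v'] changes their order only through the carries [W1]
   and [wr]. *)
have brac : ((p < v) + W1 = wr + (rho < v'))%N.
  move: vS Em; rewrite /W1 /wr; case: (leqP q (p + j)); case: (ltnP q (v + j)) => /= h1 h2; lia.
(* The index is solved from the head of the edge; by [step] it also fits the tail modulo [k + 1],
   with quotient [F - (p < v)]. *)
exists (cyc k q j w r.+1 + 1 - etaq k q j + k%:Z * (F%:Z - (p < v)%N%:Z + wr%:Z)).
  rewrite etaE PoszD c1.
  have -> : (p < v)%N%:Z = wr%:Z + (rho < v')%N%:Z - W1%:Z by lia.
  (* If [D] is the difference of the block ends at [v'] and [rho], then [i + w - 1] is [D] when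
     [rho < v'] and [k + D] otherwise; both lie in [[f, k]]. *)
  rewrite (_ : _ + _ * _ = (f * v' + below q j m v')%N%:Z - w%:Z + 1 + k%:Z
     - (rho * f)%N%:Z - (below q j m rho)%:Z - k%:Z * (rho < v')%N%:Z); last by lia.
  have rf : (rho * f = f * rho)%N := mulnC _ _.
  move: mon kE; case: (ltnP rho v') => /= h h' kE'.
    have h1 : (f * rho + f <= f * v')%N by rewrite addnC -mulnS leq_mul2l h orbT.
    have h2 : (f * v' <= f * q)%N by rewrite leq_mul2l; lia.
    by lia.
  have h1 : (f * v' <= f * rho)%N by rewrite leq_mul2l h orbT.
  have h2 : (f * rho + f <= f * q)%N by rewrite addnC -mulnS leq_mul2l rlt orbT.
  have h3 : (f <= f * v')%N by rewrite leq_pmulr; lia.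
  by lia.
by split; [apply: (@res_eq _ _ (F%:Z - (p < v)%N%:Z)) |
           apply: (@res_eq _ _ (F%:Z - (p < v)%N%:Z + wr%:Z))]; lia.
Qed.

(** * G(n,k) as a permutation *)

Definition rot_big (k : nat) : {perm 'I_k.+1} := perm (@ordS_inj k.+1).

Definition penult (k : nat) : 'I_k.+1 := inord k.-1.

Lemma penultE (k : nat) : (0 < k)%N -> penult k = k.-1 :> nat.
Proof. by move=> k0; rewrite inordK // prednK. Qed.

(** For [k > 0] this is the cycle [(0 1 ... k-1)] fixing [k]. Its factorization through [rot_big]
    makes a change of [n] act by a transposition. *)
Definition rot_small (k : nat) : {perm 'I_k.+1} :=
  (tperm (penult k) ord_max * rot_big k)%g.

(* [G(n,k)] closed by the edge from its sink [(n-2)_{k+1}] to its source [k]: the vertex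
   [(i+n-2)_{k+1}] goes to index [i - 1], then to [(i+n-1)_k], where index [k] is fixed. *)
Definition gperm (k n : nat) : {perm 'I_k.+1} :=
  (rot_big k * (rot_big k ^+ n)^-1 * rot_small k ^+ n)%g.

Lemma rot_bigX (k n : nat) (i : 'I_k.+1) :
  ((rot_big k ^+ n)%g i = (i + n) %% k.+1 :> nat)%N.
Proof.
elim: n => [|n IH]; first by rewrite expg0 perm1 addn0 modn_small.
by rewrite expgSr permM permE /= IH -addn1 modnDml addn1 addnS.
Qed.

Lemma rot_small_max (k : nat) : (0 < k)%N -> rot_small k ord_max = ord_max.
Proof.
move=> k0; rewrite permM tpermR permE; apply: ord_inj => /=.
by rewrite penultE ?prednK // modn_small.
Qed.

Lemma rot_small_lt (k : nat) (i : 'I_k.+1) : (i < k)%N ->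
  (rot_small k i = i.+1 %% k :> nat)%N.
Proof.
move=> ik; have k0 : (0 < k)%N by lia.
have mE := @penultE k k0.
rewrite permM; case: tpermP => [-> | E | /eqP n1 /eqP n2].
- by rewrite permE /= mE prednK // !modnn.
- by move: ik; rewrite E /= ltnn.
have : (i != k.-1 :> nat)%N by rewrite -mE.
by move=> h; rewrite permE /= !modn_small //; lia.
Qed.

Lemma rot_smallX (k n : nat) (i : 'I_k.+1) : (i < k)%N ->
  ((rot_small k ^+ n)%g i = (i + n) %% k :> nat)%N.
Proof.
move=> ik; have k0 : (0 < k)%N by lia.
elim: n => [|n IH]; first by rewrite expg0 perm1 addn0 modn_small.
have lt : ((rot_small k ^+ n)%g i < k)%N by rewrite IH ltn_pmod.
by rewrite expgSr permM rot_small_lt // IH -addn1 modnDml addn1 addnS.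
Qed.

Lemma rot_smallX_max (k n : nat) : (0 < k)%N ->
  (rot_small k ^+ n)%g ord_max = ord_max.
Proof.
move=> k0; elim: n => [|n IH]; first by rewrite expg0 perm1.
by rewrite expgSr permM IH rot_small_max.
Qed.

(** Moving the transposition to the right of [rot_big] conjugates it into [(0 k)], which governs the
    step to smaller [n]. *)
Lemma rot_smallE (k : nat) : (0 < k)%N ->
  rot_small k = (rot_big k * tperm ord0 ord_max)%g.
Proof.
move=> k0.
have mE := @penultE k k0.
have c1 : rot_big k (penult k) = ord_max.
  by apply: ord_inj; rewrite permE /= mE prednK // modn_small.
have c2 : rot_big k ord_max = ord0 by apply: ord_inj; rewrite permE /= modnn.
have -> : tperm ord0 ord_max = (tperm (penult k) ord_max ^ rot_big k)%g.
  by rewrite tpermJ c1 c2 tpermC.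
by rewrite conjgE !mulgA mulgV mul1g.
Qed.

Lemma gperm_edge (k n i : nat) (a b : 'I_k.+1) : (i < k)%N ->
  a.+1 = i + n %[mod k.+1] -> b = ((i + n) %% k)%N :> nat -> gperm k n a = b.
Proof.
move=> ik Ea Eb; have ik1 : (i < k.+1)%N by lia.
rewrite /gperm !permM.
have -> : ((rot_big k ^+ n)^-1)%g (rot_big k a) = Ordinal ik1.
  apply: (canLR (permK _)); apply: ord_inj; rewrite rot_bigX permE /=.
  exact: Ea.
by apply: ord_inj; rewrite rot_smallX.
Qed.

Lemma gperm_sink (k n : nat) (a : 'I_k.+1) : (0 < k)%N ->
  a.+1 = k + n %[mod k.+1] -> gperm k n a = ord_max.
Proof.
move=> k0 Ea; rewrite /gperm !permM.
have -> : ((rot_big k ^+ n)^-1)%g (rot_big k a) = ord_max.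
  by apply: (canLR (permK _)); apply: ord_inj; rewrite rot_bigX permE /=.
by rewrite rot_smallX_max.
Qed.

Lemma gperm_periodic (k n : nat) : (0 < k)%N ->
  gperm k (n + (k ^ 2 + k)) = gperm k n.
Proof.
move=> k0.
have big1 : (rot_big k ^+ k.+1 = 1)%g.
  by apply/permP => i; apply: ord_inj; rewrite rot_bigX perm1 modnDr modn_small.
have small1 : (rot_small k ^+ k = 1)%g.
  apply/permP => i; apply: ord_inj; rewrite perm1.
  case: (ltnP i k) => ik; first by rewrite rot_smallX // modnDr modn_small.
  have -> : i = ord_max by apply: ord_inj => /=; have := ltn_ord i; lia.
  by rewrite rot_smallX_max.
have LE : (k ^ 2 + k = k.+1 * k)%N by rewrite -mulnn mulSn addnC.
have Lbig : (rot_big k ^+ (k ^ 2 + k) = 1)%g by rewrite LE expgM big1 expg1n.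
have Lsmall : (rot_small k ^+ (k ^ 2 + k) = 1)%g.
  by rewrite LE mulnC expgM small1 expg1n.
by rewrite /gperm (expgD _ n) Lbig (expgD _ n) Lsmall !mulg1.
Qed.

Lemma card_porbitsJ (T : finType) (s t : {perm T}) :
  #|porbits (s ^ t)%g| = #|porbits s|.
Proof.
have im x : porbit (s ^ t)%g (t x) = t @: porbit s x.
  apply/setP => y; apply/porbitP/imsetP => [[i ->]|[z /porbitP[i ->] ->]].
    by exists ((s ^+ i)%g x); rewrite ?mem_porbit // -conjXg permJ.
  by exists i; rewrite -conjXg permJ.
have -> : porbits (s ^ t)%g = (fun A : {set T} => t @: A) @: porbits s.
  apply/setP => A; apply/imsetP/imsetP => [[x _ ->]|[B /imsetP[x _ ->] ->]].
    by exists (porbit s (t^-1%g x)); rewrite ?imset_f // -im permKV.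
  by exists (t x); rewrite ?im.
by rewrite card_imset //; apply: imset_inj; apply: perm_inj.
Qed.

(** As [t = d c^-1], conjugation by [d] cancels the leading [d] and supplies the missing factor [d]
    on the right. *)
Lemma twist_succ (G : finGroupType) (c d t : G) (n : nat) : (d = t * c)%g ->
  (c * (c ^+ n.+1)^-1 * d ^+ n.+1 = (t * (c * (c ^+ n)^-1 * d ^+ n)) ^ d)%g.
Proof.
move=> dE; have -> : (t = d * c^-1)%g by rewrite dE mulgK.
by rewrite conjgE !expgSr invMg !mulgA mulgV mulVg !mul1g ?mulVg ?mul1g.
Qed.

Lemma twist_pred (G : finGroupType) (c d t : G) (n : nat) : (d^-1 = t * c^-1)%g ->
  (c * (c ^+ n)^-1 * d ^+ n = (t * (c * (c ^+ n.+1)^-1 * d ^+ n.+1)) ^ d^-1)%g.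
Proof.
move=> dE; have -> : (t = d^-1 * c)%g by rewrite dE mulgKV.
by rewrite conjgE invgK !expgSr invMg !mulgA mulgV !mul1g !mulgK.
Qed.

Lemma gpermS (k n : nat) :
  (gperm k n.+1 = (tperm (penult k) ord_max * gperm k n) ^ rot_small k)%g.
Proof. exact: twist_succ. Qed.

Lemma gpermP (k n : nat) : (0 < k)%N ->
  (gperm k n = (tperm ord0 ord_max * gperm k n.+1) ^ (rot_small k)^-1)%g.
Proof. by move=> k0; apply: twist_pred; rewrite rot_smallE // invMg tpermV. Qed.

Definition ncyc (k n : nat) : nat := #|porbits (gperm k n)|.

(** A transposition splits the orbit containing both its points, or else merges their two orbits; so
    the count falls exactly when [k - 1] is off the orbit of [k]. *)
Lemma ncycS (k n : nat) : (0 < k)%N ->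
  (ncyc k n.+1 + (penult k \notin porbit (gperm k n) ord_max).*2
   = (ncyc k n).+1)%N.
Proof.
move=> k0; rewrite /ncyc gpermS card_porbitsJ porbits_mul_tperm.
by rewrite -val_eqE /= penultE // -[X in _ + _ = X]addn1; congr addn; lia.
Qed.

Lemma ncycP (k n : nat) : (0 < k)%N ->
  (ncyc k n + (ord0 \notin porbit (gperm k n.+1) ord_max).*2
   = (ncyc k n.+1).+1)%N.
Proof.
move=> k0; rewrite /ncyc [in LHS]gpermP // card_porbitsJ porbits_mul_tperm.
by rewrite -val_eqE /= -[X in _ + _ = X]addn1; congr addn; lia.
Qed.

Lemma ncyc_bounds (k n : nat) : (0 < ncyc k n <= k.+1)%N.
Proof.
apply/andP; split; first by apply/card_gt0P; exists (porbit (gperm k n) ord0); exact: imset_f.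
by apply: leq_trans (leq_imset_card _ _) _; rewrite card_ord.
Qed.

(** The period is a multiple of both [k] and [k + 1], so [n] and [x] give the same edges. *)
Lemma gperm_Gedge (k n : nat) (x : int) (a b : 'I_k.+1) :
  (n%:Z = x %[mod (k ^ 2 + k)%N%:Z])%Z -> Gedge x k a%:Z b%:Z ->
  gperm k n a = b.
Proof.
move=> /eqP; rewrite eqz_mod_dvd => /dvdzP[c nx] [i' [/andP[]]].
case: i' => // i _ ik [Ea Eb].
have nE : n%:Z = x + c * k%:Z * k.+1%:Z.
  by rewrite -(subrK x n%:Z) nx; lia.
apply: (@gperm_edge k n i) => //.
  apply/eqP; rewrite -eqz_nat -!modz_nat eqz_mod_dvd.
  rewrite -addn1 PoszD Ea PoszD nE /res.
  rewrite (divz_eq (i.+1%:Z + x - 2) k.+1%:Z).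
  apply/dvdzP; exists (- ((i.+1%:Z + x - 2) %/ k.+1%:Z)%Z - c * k%:Z).
  by rewrite modzMDl modz_mod; have := divz_eq (i.+1%:Z + x - 2) k.+1%:Z; lia.
apply/eqP; rewrite -eqz_nat -modz_nat Eb /res eqz_mod_dvd; apply/dvdzP.
exists (- (c * k.+1%:Z)); rewrite PoszD nE; lia.
Qed.

(** Iterating [gperm] from a vertex of the cycle stays on the cycle, whose vertices are all below
    [k]. *)
Lemma cycle_avoids_max (k q n : nat) (x : int) (c : nat -> int) (r : nat) :
  (n%:Z = x %[mod (k ^ 2 + k)%N%:Z])%Z ->
  (forall s, (s < q)%N -> 0 <= c s < k%:Z) ->
  (forall s, (s < q)%N -> Gedge x k (c s) (c s.+1)) ->
  c q = c 0%N -> (r < q)%N ->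
  forall v : 'I_k.+1, v%:Z = c r -> v \notin porbit (gperm k n) ord_max.
Proof.
move=> nx rng edge cq rq v vE; rewrite porbit_sym; apply/porbitP => -[i iE].
have [s sq sE] : exists2 s, (s < q)%N & ((gperm k n ^+ i)%g v)%:Z = c s.
  elim: i {iE} => [|i [s sq sE]]; first by exists r; rewrite // expg0 perm1.
  have [s' s'q s'E] : exists2 s', (s' < q)%N & c s' = c s.+1.
    case: (ltnP s.+1 q) => h; first by exists s.+1.
    by exists 0%N; [lia | rewrite -cq; congr c; lia].
  exists s' => //; rewrite expgSr permM s'E.
  have /andP[c0 ck] := rng s' s'q.
  have lt : (`|c s'| < k.+1)%N by lia.
  rewrite (@gperm_Gedge k n x _ (Ordinal lt)) //= ?sE; first by lia.
  by have := edge s sq; rewrite -s'E (_ : `|c s'|%N%:Z = c s') //; lia.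
by have := rng s sq; rewrite -sE -iE /=; lia.
Qed.

(** * The kernel of A(n,k) *)

(** The powers [rot_big ^+ k.+1] and [rot_small ^+ k] are trivial, so raising both exponents by [k]
    absorbs the leading [rot_big]. The exponent [n + k] is the degree shift used in [spread]. *)
Lemma gpermE (k n : nat) : (0 < k)%N ->
  gperm k n = ((rot_big k ^+ (n + k))^-1 * rot_small k ^+ (n + k))%g.
Proof.
move=> k0; apply/permP => a; rewrite [in RHS]permM.
set i := ((rot_big k ^+ (n + k))^-1)%g a.
have aE : a = (rot_big k ^+ (n + k))%g i by rewrite permKV.
have a1 : a.+1 = i + n %[mod k.+1].
  by rewrite aE rot_bigX -addn1 modnDml -addnA -addnA addn1 addnA modnDr.
case: (ltnP i k) => ik.
  by apply: (@gperm_edge k n i) => //; rewrite rot_smallX // addnA modnDr.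
have iE : i = ord_max by apply: ord_inj => /=; have := ltn_ord i; lia.
by rewrite iE rot_smallX_max //; apply: gperm_sink => //; rewrite a1 iE.
Qed.

(* The generating polynomial of the band of [Amat n k], shifted by [X^k]. *)
Definition symb (k : nat) : {poly rat} := (\sum_(i < k) 'X^i) * (1 - 'X^(k.+1)).

(** The coefficients are indexed by all vertices [0..k] so that both rotations act on them;
    [symb_dvd_spread] asks for zero entries at [k]. *)
Definition spread (k N : nat) (u v : 'I_k.+1 -> rat) : {poly rat} :=
  \sum_(i < k.+1) u i *: 'X^i + \sum_(i < k.+1) v i *: 'X^(N + i).

Lemma dvdp_Xn_mod (d l : nat) :
  ('X^d - 1 : {poly rat}) %| 'X^l - 'X^(l %% d).
Proof.
rewrite {1}(divn_eq l d) exprD mulnC exprM -{2}['X^(l %% d)]mul1r -mulrBl.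
by rewrite dvdp_mulr // (subrX1 'X^d) dvdp_mulr.
Qed.

Lemma coef_sumXn (m : nat) (f : 'I_m -> rat) (i : 'I_m) :
  (\sum_(b < m) f b *: ('X^b : {poly rat}))`_i = f i.
Proof.
rewrite coef_sum (bigD1 i) //= coefZ coefXn eqxx mulr1 big1 ?addr0 // => b bi.
by rewrite coefZ coefXn; case: eqP => [/ord_inj E|_]; rewrite ?mulr0 // E eqxx in bi *.
Qed.

Lemma coef_sumXn_ge (m l : nat) (f : 'I_m -> rat) : (m <= l)%N ->
  (\sum_(b < m) f b *: ('X^b : {poly rat}))`_l = 0.
Proof.
move=> ml; rewrite coef_sum big1 // => b _; rewrite coefZ coefXn.
by case: eqP => [E|_]; rewrite ?mulr0 //; have := ltn_ord b; lia.
Qed.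

(* Modulo [X^d - 1] the two halves of [spread] overlap and must cancel. *)
Lemma dvdp_spread (k d N : nat) (t : {perm 'I_k.+1}) (u v : 'I_k.+1 -> rat) :
  (0 < d)%N ->
  (forall i : 'I_k.+1, (d <= i)%N -> [/\ u i = 0, v i = 0 & t i = i]) ->
  (forall i : 'I_k.+1, (i < d)%N -> t i = ((N + i) %% d)%N :> nat) ->
  reflect (forall i, u (t i) = - v i) (('X^d - 1) %| spread k N u v).
Proof.
move=> d0 tge tlt.
(* [R] is the remainder modulo [X^d - 1]: the upper half is folded onto the exponents [t i], and
   coefficients from [d] on vanish. *)
pose R := \sum_(b < k.+1) (u b + v (t^-1%g b)) *: ('X^b : {poly rat}).
have RE : R = \sum_(i < k.+1) u i *: 'X^i + \sum_(i < k.+1) v i *: 'X^(t i).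
  rewrite /R; under eq_bigr do rewrite scalerDl.
  rewrite big_split /=; congr (_ + _).
  by rewrite (reindex_inj (@perm_inj _ t)) /=; under eq_bigr do rewrite permK.
have cong : ('X^d - 1 : {poly rat}) %| spread k N u v - R.
  rewrite RE /spread opprD addrACA subrr add0r -sumrB.
  apply: (big_ind (fun p => ('X^d - 1 : {poly rat}) %| p)).
  - exact: dvdp0.
  - by move=> p1 p2; apply: dvdp_add.
  move=> i _; rewrite -scalerBr; case: (ltnP i d) => id.
    by rewrite (tlt i id) -mul_polyC dvdp_mull // dvdp_Xn_mod.
  by have [_ -> _] := tge i id; rewrite scale0r dvdp0.
have sizeR : (size R <= d)%N.
  apply/leq_sizeP => l dl; case: (ltnP l k.+1) => lk; last exact: coef_sumXn_ge.
  have := @coef_sumXn k.+1 (fun b => u b + v (t^-1%g b)) (Ordinal lk) => /= ->.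
  have [u0 v0 tl] := tge (Ordinal lk) dl.
  by rewrite -{2}tl permK u0 v0 addr0.
have -> : (('X^d - 1) %| spread k N u v) = (R == 0).
  rewrite -[spread _ _ _ _](subrK R) dvdp_addr //.
  apply/idP/eqP => [h|->]; last exact: dvdp0.
  apply/eqP; case: eqP => // /eqP R0.
  by have := dvdp_leq R0 h; rewrite size_XnsubC // leqNgt ltnS sizeR.
apply: (iffP eqP) => [R0 i|H].
  apply/eqP; rewrite -addr_eq0; apply/eqP.
  have := @coef_sumXn k.+1 (fun b => u b + v (t^-1%g b)) (t i).
  by rewrite -/R R0 coef0 permK => <-.
by rewrite /R big1 // => b _; rewrite -{1}(permKV t b) H addNr scale0r.
Qed.

(** With [U = 1 + ... + X^(k-1)], the polynomial [X^(k+1) - 1] is [X - 1] modulo [U], and [U] takes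
    the nonzero value [k] at [1]; so the two are coprime. The other factor [X - 1] of [X^k - 1]
    already divides [X^(k+1) - 1]. *)
Lemma symb_dvdE (k : nat) (Q : {poly rat}) : (0 < k)%N ->
  (symb k %| Q) = ('X^k - 1 %| Q) && ('X^(k.+1) - 1 %| Q).
Proof.
move=> k0; rewrite /symb.
set U := \sum_(i < k) 'X^i.
have XU : 'X^k - 1 = ('X - 1) * U := subrX1 _ _.
have X1 : 'X^(k.+1) - 1 = ('X * ('X - 1)) * U + ('X - 1%:P) :> {poly rat}.
  by rewrite -mulrA -XU exprS; ring.
have cop : coprimep U ('X^(k.+1) - 1).
  rewrite X1 coprimep_addl_mul coprimep_XsubC /root /U horner_sum.
  under eq_bigr do rewrite hornerXn expr1n.
  by rewrite sumr_const card_ord pnatr_eq0; lia.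
rewrite -[1 - _]opprB mulrN -dvdpNl opprK Gauss_dvdp //.
have [h|] := boolP ('X^(k.+1) - 1 %| Q); last by rewrite !andbF.
rewrite !andbT; apply/idP/idP => [UQ|]; last first.
  by apply: dvdp_trans; rewrite XU dvdp_mull.
have cop1 : coprimep ('X - 1 : {poly rat}) U.
  move: cop; rewrite X1 coprimep_addl_mul coprimep_sym //.
rewrite XU Gauss_dvdp // UQ andbT; apply: dvdp_trans h.
by rewrite subrX1 dvdp_mulr.
Qed.

Lemma symb_coef (k l : nat) :
  (symb k)`_l = (l < k)%N%:R - (k < l <= k + k)%N%:R.
Proof.
rewrite /symb mulrBr mulr1 coefB coefMXn.
have Uc j : (\sum_(i < k) 'X^i : {poly rat})`_j = (j < k)%N%:R.
  have E : \sum_(i < k) 'X^i = \sum_(i < k) (1 : rat) *: 'X^i.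
    by apply: eq_bigr => i _; rewrite scale1r.
  rewrite E; case: (ltnP j k) => jk; last by rewrite coef_sumXn_ge.
  by have := @coef_sumXn k (fun=> 1) (Ordinal jk).
rewrite !Uc; congr (_ - _); case: (ltnP l k.+1) => lk //=.
by congr (nat_of_bool _)%:R; lia.
Qed.

Lemma coef_rVpolyM (n l : nat) (x : 'rV[rat]_n) (p : {poly rat}) :
  (rVpoly x * p)`_l = \sum_(i < n) x 0 i * ('X^i * p)`_l.
Proof.
have -> : rVpoly x = \sum_(i < n) x 0 i *: 'X^i.
  by rewrite /rVpoly poly_def; apply: eq_bigr => i _; rewrite valK.
by rewrite mulr_suml coef_sum; apply: eq_bigr => i _; rewrite -scalerAl coefZ.
Qed.

(** The offset [k] puts the diagonal on the zero coefficient at [X^k]; the superdiagonals meet the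
    block of [-1], whence the sign. *)
Lemma Amat_symb (n k : nat) (x : 'rV[rat]_n) (j : 'I_n) :
  (x *m Amat n k) 0 j = - (rVpoly x * symb k)`_(j + k).
Proof.
rewrite coef_rVpolyM mxE -sumrN; apply: eq_bigr => i _; rewrite mxE -mulrN.
congr (_ * _); rewrite coefXnM symb_coef.
case: (ltnP (j + k) i) => ijk.
  by rewrite oppr0 ifF 1?ifF //; lia.
have -> : (j + k - i < k)%N = (j < i <= j + k)%N by lia.
have -> : (k < j + k - i <= k + k)%N = (i < j <= i + k)%N by lia.
case: (ltngtP i j) => ij /=; rewrite ?subrr ?oppr0 ?sub0r ?opprK //.
  by case: leqP.
by rewrite ijk subr0.
Qed.

Lemma spread_coef (k N l : nat) (u v : 'I_k.+1 -> rat) :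
  (spread k N u v)`_l = (\sum_(i < k.+1) u i *: 'X^i)`_l +
    (if (l < N)%N then 0 else (\sum_(i < k.+1) v i *: 'X^i)`_(l - N)).
Proof.
rewrite /spread coefD -coefXnM mulr_sumr; congr (_ + (polyseq _)`_l).
by apply: eq_bigr => i _; rewrite -scalerAr exprD.
Qed.

Lemma coef_sumXn_max (k l : nat) (u : 'I_k.+1 -> rat) : u ord_max = 0 ->
  (k <= l)%N -> (\sum_(i < k.+1) u i *: ('X^i : {poly rat}))`_l = 0.
Proof.
move=> u0; rewrite leq_eqVlt => /orP[/eqP <-|]; last exact: coef_sumXn_ge.
by have := @coef_sumXn k.+1 u ord_max; rewrite u0.
Qed.

Lemma spread_low (k N : nat) (u v : 'I_k.+1 -> rat) (a : 'I_k.+1) :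
  (k <= N)%N -> (a < k)%N -> (spread k N u v)`_a = u a.
Proof.
by move=> kN ak; rewrite spread_coef coef_sumXn ifT ?addr0 // (leq_trans ak).
Qed.

Lemma spread_mid (k N l : nat) (u v : 'I_k.+1 -> rat) : u ord_max = 0 ->
  (k <= l < N)%N -> (spread k N u v)`_l = 0.
Proof.
by move=> u0 /andP[kl lN]; rewrite spread_coef lN addr0 coef_sumXn_max.
Qed.

Lemma spread_size (k N : nat) (u v : 'I_k.+1 -> rat) : u ord_max = 0 ->
  v ord_max = 0 -> (k <= N)%N -> (size (spread k N u v) <= N + k)%N.
Proof.
move=> u0 v0 kN; apply/leq_sizeP => l lN; rewrite spread_coef ifF; last by lia.
by rewrite !coef_sumXn_max ?addr0 //; lia.
Qed.

(** This is [dvdp_spread] for [d = k] and [d = k + 1]. Eliminating [v] between the two conditions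
    will leave the invariance of [u] under [gperm k n]. *)
Lemma symb_dvd_spread (k n : nat) (u v : 'I_k.+1 -> rat) : (0 < k)%N ->
  u ord_max = 0 -> v ord_max = 0 ->
  (symb k %| spread k (n + k) u v) <->
  (forall i, u ((rot_small k ^+ (n + k))%g i) = - v i) /\
  (forall i, u ((rot_big k ^+ (n + k))%g i) = - v i).
Proof.
move=> k0 u0 v0; rewrite symb_dvdE //.
have last_ge (i : 'I_k.+1) : (k <= i)%N -> i = ord_max.
  by move=> ki; apply: ord_inj => /=; have := ltn_ord i; lia.
have isS : reflect (forall i, u ((rot_small k ^+ (n + k))%g i) = - v i)
                   ('X^k - 1 %| spread k (n + k) u v).
  apply: dvdp_spread => // i; last by move=> ik; rewrite rot_smallX // addnC.
  by move=> /last_ge ->; rewrite rot_smallX_max.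
have isB : reflect (forall i, u ((rot_big k ^+ (n + k))%g i) = - v i)
                   ('X^(k.+1) - 1 %| spread k (n + k) u v).
  apply: dvdp_spread => // i; last by rewrite rot_bigX addnC.
  by rewrite leqNgt ltn_ord.
by split => [/andP[/isS h1 /isB h2] | [/isS h1 /isB h2]]; [|apply/andP].
Qed.

Definition lows (k : nat) (Q : {poly rat}) (a : 'I_k.+1) : rat :=
  if (a < k)%N then Q`_a else 0.

Lemma lows_max (k : nat) (Q : {poly rat}) : lows k Q ord_max = 0.
Proof. by rewrite /lows ltnn. Qed.

Lemma symb_neq0 (k : nat) : (0 < k)%N -> symb k != 0.
Proof.
move=> k0; apply/eqP => /(congr1 (fun p : {poly rat} => p`_0)).
by rewrite symb_coef k0 coef0 subr0.
Qed.

(** The coefficients from [k] to [n + k - 1] are, up to sign, the entries of [x *m Amat n k]; those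
    from [n + 2k] on vanish by degree. *)
Lemma ker_spread (n k : nat) (x : 'rV[rat]_n) : (0 < k)%N -> x *m Amat n k = 0 ->
  exists2 v : 'I_k.+1 -> rat, v ord_max = 0 &
    rVpoly x * symb k = spread k (n + k) (lows k (rVpoly x * symb k)) v.
Proof.
move=> k0 xA; set Q := rVpoly x * symb k.
exists (fun i => if (i < k)%N then Q`_(n + k + i) else 0); first by rewrite /= ltnn.
set v := (fun _ => _).
have v0 : v ord_max = 0 by rewrite /v /= ltnn.
apply/polyP => l; case: (ltnP l k) => lk.
  have lk1 : (l < k.+1)%N by lia.
  have := @spread_low k (n + k) (lows k Q) v (Ordinal lk1) _ lk => /= ->; last by lia.
  by rewrite /lows /= lk.
case: (ltnP l (n + k)) => lnk.
  rewrite spread_mid ?lows_max ?lk //.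
  have jn : (l - k < n)%N by lia.
  have := congr1 (fun M : 'rV_n => M 0 (Ordinal jn)) xA.
  by rewrite /= Amat_symb mxE /= subnK // => /eqP; rewrite oppr_eq0 => /eqP.
rewrite spread_coef ifF; last by lia.
rewrite coef_sumXn_max ?lows_max // add0r; case: (ltnP (l - (n + k)) k) => lk2.
  have lk1 : (l - (n + k) < k.+1)%N by lia.
  have := @coef_sumXn k.+1 v (Ordinal lk1) => /= ->.
  by rewrite /v /= lk2 subnKC.
rewrite coef_sumXn_max //; apply: nth_default.
apply: leq_trans (size_polyMleq _ _) _.
have sx : (size (rVpoly x) <= n)%N := size_poly _ _.
have sP : (size (symb k) <= (k + k).+1)%N.
  apply/leq_sizeP => i ki; rewrite symb_coef.
  by rewrite (_ : (i < k)%N = false) 1?(_ : (k < i <= k + k)%N = false) //; lia.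
apply: (@leq_trans (n + (k + k).+1).-1); last by lia.
by rewrite -!subn1 leq_sub2r // leq_add.
Qed.

Lemma ker_lows_inv (n k : nat) (x : 'rV[rat]_n) : (0 < k)%N ->
  x *m Amat n k = 0 ->
  forall a, lows k (rVpoly x * symb k) (gperm k n a) = lows k (rVpoly x * symb k) a.
Proof.
move=> k0 /ker_spread[//|v v0 QE] a.
have : symb k %| spread k (n + k) (lows k (rVpoly x * symb k)) v.
  by rewrite -QE dvdp_mull.
move/(@symb_dvd_spread k n _ v k0 (lows_max _ _) v0) => [hS hB].
by rewrite gpermE // permM hS -hB permKV.
Qed.

(** The low coefficients determine the high ones through the rotation, hence the whole product. *)
Lemma ker_lows_eq0 (n k : nat) (x : 'rV[rat]_n) : (0 < k)%N ->
  x *m Amat n k = 0 -> (forall a, lows k (rVpoly x * symb k) a = 0) -> x = 0.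
Proof.
move=> k0 /ker_spread[//|v v0 QE] l0.
have : symb k %| spread k (n + k) (lows k (rVpoly x * symb k)) v.
  by rewrite -QE dvdp_mull.
move/(@symb_dvd_spread k n _ v k0 (lows_max _ _) v0) => [hS _].
have : rVpoly x * symb k = 0.
  rewrite QE /spread !big1 ?addr0 // => i _; last by rewrite l0 scale0r.
  by rewrite -[v i]opprK -hS l0 oppr0 scale0r.
move/eqP; rewrite mulf_eq0 (negbTE (symb_neq0 k k0)) orbF => /eqP x0.
by rewrite -[x]rVpolyK x0 linear0.
Qed.

(** The rotation prescribes [v], and invariance of [u] makes the resulting [spread] divisible by
    [symb k]; the quotient is the required vector. *)
Lemma ker_lows_exists (n k : nat) (u : 'I_k.+1 -> rat) : (0 < k)%N ->
  u ord_max = 0 -> (forall a, u (gperm k n a) = u a) ->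
  exists2 x : 'rV[rat]_n, x *m Amat n k = 0 &
    forall a, lows k (rVpoly x * symb k) a = u a.
Proof.
move=> k0 u0 inv.
pose v i := - u ((rot_small k ^+ (n + k))%g i).
have v0 : v ord_max = 0 by rewrite /v rot_smallX_max // u0 oppr0.
have /divpK : symb k %| spread k (n + k) u v.
  apply/(@symb_dvd_spread k n u v k0 u0 v0); split => i; rewrite opprK //.
  by rewrite -inv gpermE // permM permK.
set p := _ %/ _ => pE.
have sP : ((k + k).+1 <= size (symb k))%N.
  rewrite ltnNge; apply/negP => /leq_sizeP/(_ (k + k)%N (leqnn _))/eqP.
  have h1 : (k + k < k)%N = false by lia.
  have h2 : (k < k + k <= k + k)%N = true by lia.
  by rewrite symb_coef h1 h2 /= sub0r oppr_eq0 oner_eq0.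
(* The dividend has size at most [n + 2k] and [symb k] has degree at least [2k], so the quotient
   fits in [n] entries. *)
have sp : (size p <= n)%N.
  rewrite size_divp ?symb_neq0 //.
  have sP' : (k + k <= (size (symb k)).-1)%N by rewrite -ltnS (ltn_predK sP).
  have sQ := @spread_size k (n + k) u v u0 v0 (leq_addl _ _).
  by apply: leq_trans (leq_sub sQ sP') _; lia.
exists (poly_rV p).
  apply/rowP => j; rewrite Amat_symb poly_rV_K // pE mxE spread_mid ?oppr0 //.
  by have := ltn_ord j; lia.
move=> a; rewrite poly_rV_K // pE /lows; case: ltnP => ak; first by rewrite spread_low // leq_addl.
by rewrite (_ : a = ord_max) //; apply: ord_inj => /=; have := ltn_ord a; lia.
Qed.

(** * Invariant functions of a permutation, and the nullity *)

Section InvariantFunctions.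
Variables (m : nat) (s : {perm 'I_m}) (z : 'I_m).
Let O := porbits s :\ porbit s z.
Let orb (i : 'I_#|O|) : {set 'I_m} := enum_val i.
Let rep (i : 'I_#|O|) : 'I_m := odflt z [pick a in orb i].

(* Its rows are a basis of the [s]-invariant functions vanishing at [z]. *)
Definition orbit_mx : 'M[rat]_(#|O|, m) := \matrix_(i, a) (a \in orb i)%:R.

Let mem_orb (i : 'I_#|O|) a : (a \in orb i) = (orb i == porbit s a).
Proof.
have := enum_valP i; rewrite in_setD1 => /andP[_ /imsetP[b _ E]].
by rewrite /orb E -eq_porbit_mem eq_sym.
Qed.

Let rep_orb (i : 'I_#|O|) : rep i \in orb i.
Proof.
have := enum_valP i; rewrite in_setD1 => /andP[_ /imsetP[b _ E]].
rewrite /rep; case: pickP => //= none.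
by have := none b; rewrite /orb E porbit_id.
Qed.

(** Evaluation at one representative per orbit is a right inverse, so the rows are independent. *)
Lemma rank_orbit_mx : \rank orbit_mx = #|porbits s|.-1.
Proof.
have -> : #|porbits s|.-1 = #|O|.
  by rewrite (cardsD1 (porbit s z)) imset_f.
apply/eqP/row_freeP; exists (\matrix_(a, j) (a == rep j)%:R).
apply/matrixP => i j; rewrite !mxE (bigD1 (rep j)) //= !mxE eqxx mulr1.
rewrite big1 ?addr0; last by move=> b /negbTE bj; rewrite !mxE bj mulr0.
rewrite mem_orb (_ : porbit s (rep j) = orb j) ?(inj_eq enum_val_inj) //.
by apply/esym/eqP; rewrite -mem_orb rep_orb.
Qed.

Lemma orbit_mx_inv i a : orbit_mx i (s a) = orbit_mx i a.
Proof. by rewrite !mxE !mem_orb -[s a]/((s ^+ 1)%g a) porbit_perm. Qed.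

Lemma orbit_mx_base i : orbit_mx i z = 0.
Proof.
rewrite mxE mem_orb; have := enum_valP i.
by rewrite in_setD1 => /andP[/negbTE -> _].
Qed.

Lemma sub_orbit_mx (y : 'rV[rat]_m) : (forall a, y 0 (s a) = y 0 a) ->
  y 0 z = 0 -> (y <= orbit_mx)%MS.
Proof.
move=> inv yz; apply/submxP; exists (\row_i y 0 (rep i)).
have inv' a b : a \in porbit s b -> y 0 a = y 0 b.
  case/porbitP => l ->; elim: l => [|l IH]; first by rewrite expg0 perm1.
  by rewrite expgSr permM inv.
apply/rowP => a; rewrite mxE.
have [az|az] := boolP (a \in porbit s z).
  rewrite (inv' _ _ az) yz big1 // => i _; rewrite !mxE mem_orb.
  rewrite -eq_porbit_mem in az; rewrite (eqP az).
  by have := enum_valP i; rewrite in_setD1 => /andP[/negbTE -> _]; rewrite mulr0.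
have aO : porbit s a \in O by rewrite in_setD1 eq_porbit_mem az imset_f.
pose i0 := enum_rank_in aO (porbit s a).
have oi : orb i0 = porbit s a by rewrite /orb enum_rankK_in.
rewrite (bigD1 i0) //= !mxE mem_orb oi eqxx mulr1 big1 ?addr0.
  by apply: inv'; rewrite porbit_sym -oi rep_orb.
move=> i ii; rewrite !mxE mem_orb -oi (inj_eq enum_val_inj).
by rewrite (negbTE ii) mulr0.
Qed.

End InvariantFunctions.

(** Taking low coefficients is linear and injective on the kernel; its image is the space of
    invariant functions vanishing at [k], with one dimension for each orbit other than that of
    [k]. *)
Lemma Nnat_ncyc (n k : nat) : (0 < k)%N -> Nnat n k = (ncyc k n).-1.
Proof.
move=> k0; rewrite /Nnat -mxrank_ker /ncyc -(@rank_orbit_mx k.+1 (gperm k n) ord_max).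
pose Phi : 'M[rat]_(n, k.+1) := \matrix_(i, a) lows k ('X^i * symb k) a.
have PhiE x a : (x *m Phi) 0 a = lows k (rVpoly x * symb k) a.
  rewrite mxE /lows; case: ltnP => ak.
    by rewrite coef_rVpolyM; apply: eq_bigr => i _; rewrite mxE /lows ak.
  by rewrite big1 // => i _; rewrite mxE /lows ltnNge ak mulr0.
have -> : \rank (kermx (Amat n k)) = \rank (kermx (Amat n k) *m Phi).
  symmetry; apply/mxrank_injP/eqP/row_matrixP => i; rewrite row0.
  have := row_sub i (kermx (Amat n k) :&: kermx Phi)%MS.
  rewrite sub_capmx => /andP[/sub_kermxP xA /sub_kermxP xP].
  by apply: (@ker_lows_eq0 n k) => // a; rewrite -PhiE xP mxE.
apply: eqmx_rank; apply/andP; split; apply/row_subP => i.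
  have xA : row i (kermx (Amat n k)) *m Amat n k = 0.
    by apply/sub_kermxP; apply: row_sub.
  rewrite row_mul; apply: sub_orbit_mx; last by rewrite PhiE lows_max.
  by move=> a; rewrite !PhiE ker_lows_inv.
have [||x xA xu] := @ker_lows_exists n k (orbit_mx k.+1 (gperm k n) ord_max i) k0.
- exact: orbit_mx_base.
- exact: orbit_mx_inv.
have -> : row i (orbit_mx k.+1 (gperm k n) ord_max) = x *m Phi.
  by apply/rowP => a; rewrite PhiE xu mxE.
by apply: submxMr; apply/sub_kermxP.
Qed.

(** * The walk N(n,k) *)

Lemma ncyc_mod (k n n' : nat) : (0 < k)%N -> n = n' %[mod (k ^ 2 + k)] ->
  ncyc k n = ncyc k n'.
Proof.
move=> k0; have per c l : ncyc k (l + c * (k ^ 2 + k)) = ncyc k l.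
  elim: c => [|c IH]; first by rewrite mul0n addn0.
  by rewrite mulSn addnCA addnC /ncyc gperm_periodic.
have red l : ncyc k l = ncyc k (l %% (k ^ 2 + k)).
  by rewrite {1}(divn_eq l (k ^ 2 + k)) addnC per.
by move=> E; rewrite red E -red.
Qed.

Lemma Nk_ncyc (k n : nat) (x : int) : (0 < k)%N ->
  (n%:Z = x %[mod (k ^ 2 + k)%N%:Z])%Z -> (Nk x k).+1 = ncyc k n.
Proof.
move=> k0 E; rewrite /Nk Nnat_ncyc //.
have /andP[c0 _] := ncyc_bounds k (`|(x %% (k ^ 2 + k)%N%:Z)%Z| + (k ^ 2 + k)).
rewrite prednK //; apply: ncyc_mod => //.
by rewrite modnDr -E modz_nat absz_nat modn_mod.
Qed.

Lemma Nk_mod (k : nat) (x y h : int) :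
  (x = y %[mod (k ^ 2 + k)%N%:Z])%Z -> Nk (x + h) k = Nk (y + h) k.
Proof. by move=> E; rewrite /Nk -modzDml E modzDml. Qed.

Lemma Nk_congr (k : nat) (x y : int) :
  (x = y %[mod (k ^ 2 + k)%N%:Z])%Z -> Nk x k = Nk y k.
Proof. by move=> E; rewrite /Nk E. Qed.

Lemma Nk_nat_rep (k : nat) (x : int) : (0 < k)%N ->
  exists2 n : nat, (n%:Z = x %[mod (k ^ 2 + k)%N%:Z])%Z &
    (n.+1%:Z = x + 1 %[mod (k ^ 2 + k)%N%:Z])%Z.
Proof.
move=> k0; have E : `|(x %% (k ^ 2 + k)%N%:Z)%Z|%N%:Z = (x %% (k ^ 2 + k)%N%:Z)%Z.
  by rewrite gez0_abs // modz_ge0 //; lia.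
exists `|(x %% (k ^ 2 + k)%N%:Z)%Z|%N; first by rewrite E modz_mod.
by rewrite -addn1 PoszD E modzDml.
Qed.

Lemma Nk_step (k : nat) (x : int) : (0 < k)%N ->
  Nk (x + 1) k = (Nk x k).+1 \/ Nk x k = (Nk (x + 1) k).+1.
Proof.
move=> k0; have [n n0 n1] := Nk_nat_rep k x k0.
have := Nk_ncyc k n x k0 n0; have := Nk_ncyc k n.+1 (x + 1) k0 n1.
by have := ncycS k n k0; case: (_ \notin _) => /=; clear; lia.
Qed.

Lemma Nk_le (k : nat) (x : int) : (0 < k)%N -> (Nk x k <= k)%N.
Proof.
move=> k0; have [n n0 _] := Nk_nat_rep k x k0.
by have := Nk_ncyc k n x k0 n0; have := ncyc_bounds k n; clear; lia.
Qed.

(** The index [r] is the inverse of [j] modulo [q]. It locates block [1], where [c_f] takes the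
    value [0] and [c_1] the value [f - 1]. *)
Lemma slot_eq1 (q j : nat) : (1 <= j <= q)%N -> coprime j q ->
  exists2 r, (r < q)%N & slot q j r = 1%N.
Proof.
move=> /andP[j0 jq] cjq; have q0 : (0 < q)%N by lia.
have /(coprimeP _ j0)[[u v] /= uv] := cjq.
exists (u %% q)%N; first by rewrite ltn_pmod.
apply: (@mod_rep_inj q); first by apply: slot_bounds => //; rewrite ltnW // ltn_pmod.
  by rewrite q0.
rewrite slot_mod modnMml; have -> : (u * j = v * q + 1)%N by lia.
by rewrite modnMDl.
Qed.

Lemma below1 (q j m : nat) : (0 < q)%N -> coprime j q -> (m < q)%N ->
  below q j m 1 = 0%N.
Proof.
move=> q0 cjq mq; apply/eqP; rewrite -leqn0 leqNgt -has_count; apply/hasPn => a.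
rewrite mem_iota => /andP[a1 am]; rewrite -leqNgt lt0n; apply/eqP => E.
have : a = 0%N by apply: (@modn_coprime_inj q j) => //; [lia|rewrite E mod0n].
by lia.
Qed.

Lemma fq_gt0 (k q : nat) : (1 <= q <= k)%N -> (0 < fq k q)%N.
Proof. by move=> /andP[q0 qk]; rewrite divn_gt0. Qed.

(** * Monotone runs of N on both sides of eta(q,j) *)

Section Peaks.
Variables (k q j : nat).
Hypotheses (hq : (1 <= q <= k)%N) (hj : (1 <= j <= q)%N) (cjq : coprime j q).
Let f := fq k q.
Let eta := etaq k q j.

Lemma cyc_Gedge (w : nat) (h : int) (r : nat) : (1 <= w <= f)%N ->
  1 - w%:Z <= h <= f%:Z - w%:Z -> (r < q)%N ->
  Gedge (eta + h) k (cyc k q j w r) (cyc k q j w r.+1).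
Proof.
move=> hw hh rq; have [i hi [E0 E1]] := cyc_edge k q j w r hq hj cjq hw rq.
(* Shifting the graph by [h] renumbers edge [i] as [i - h]; the bounds on [i] and [h] keep this in
   [[1, k]]. *)
exists `|i - h|%N; rewrite E0 E1; split; first by lia.
by split; congr res; rewrite -/eta; lia.
Qed.

Lemma cyc_loop (w : nat) : cyc k q j w q = cyc k q j w 0.
Proof. by rewrite /cyc eqxx orbT. Qed.

Lemma cyc_avoids_max (w n r : nat) (h : int) (v : 'I_k.+1) : (1 <= w <= f)%N ->
  1 - w%:Z <= h <= f%:Z - w%:Z ->
  (n%:Z = eta + h %[mod (k ^ 2 + k)%N%:Z])%Z -> (r < q)%N ->
  v%:Z = cyc k q j w r -> v \notin porbit (gperm k n) ord_max.
Proof.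
move=> hw hh nE rq vE.
apply: (@cycle_avoids_max k q n (eta + h) (cyc k q j w) r) => // [s sq|s sq|].
- by apply: cyc_range => //; lia.
- exact: cyc_Gedge.
- exact: cyc_loop.
Qed.

Lemma eta_down (i : nat) : (i < f)%N ->
  Nk (eta + i%:Z) k = (Nk (eta + i%:Z + 1) k).+1.
Proof.
move=> ilt; have k0 : (0 < k)%N by lia.
have hi : 1 - 1%:Z <= i%:Z <= f%:Z - 1%:Z by lia.
have f0 := fq_gt0 k q hq; have q0 : (0 < q)%N by lia.
have [n n0 n1] := Nk_nat_rep k (eta + i%:Z) k0.
have := Nk_ncyc k n _ k0 n0; have := Nk_ncyc k n.+1 _ k0 n1.
have av : penult k \notin porbit (gperm k n) ord_max.
  apply: (@cyc_avoids_max 1 n 0 i%:Z) => //.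
  by rewrite penultE // /cyc /=; clear -k0; lia.
by have := ncycS k n k0; rewrite av /=; clear; lia.
Qed.

Lemma eta_up (i : nat) : (i < f)%N ->
  Nk (eta - i%:Z) k = (Nk (eta - i%:Z - 1) k).+1.
Proof.
move=> ilt; have k0 : (0 < k)%N by lia.
have q0 : (0 < q)%N by lia.
have f0 := fq_gt0 k q hq; have hf : (1 <= f <= f)%N by rewrite f0 /=.
have hi : 1 - f%:Z <= - i%:Z <= f%:Z - f%:Z by lia.
have [n n0 n1] := Nk_nat_rep k (eta - i%:Z - 1) k0.
rewrite subrK in n1.
have := Nk_ncyc k n _ k0 n0; have := Nk_ncyc k n.+1 _ k0 n1.
have [r rq r1] := slot_eq1 q j hj cjq.
have av : ord0 \notin porbit (gperm k n.+1) ord_max.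
  apply: (@cyc_avoids_max f n.+1 r (- i%:Z)) => //.
  by rewrite cycE ?(ltnW rq) // r1 below1 ?mq_lt // -/f muln1 addn0 subrr.
by have := ncycP k n k0; rewrite av /=; clear; lia.
Qed.

(** Write [(k + 1) j = F q + rho]. Since [rho f + s <= k - f], the upper bound holds when [F <= k];
    and [F = k + 1] forces [j = q = 1], where [eta = k^2]. Positivity could fail only for [F = 1]
    and [rho = 0], but [(k + 1) j > q]. *)
Lemma eta_range : 0 < eta < (k ^ 2 + k)%N%:Z.
Proof.
have q0 : (0 < q)%N by lia.
have f0 := fq_gt0 k q hq; have kE : (k = f * q + mq k q)%N := k_eq k q.
have mlt := mq_lt k q q0.
have sm : (sq k q j <= mq k q)%N by rewrite sqE // below_size.
rewrite /eta /etaq -/f.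
set F := ((k + 1) * j %/ q)%N; set rho := (Mq k q * j %% q)%N.
have rlt : (rho < q)%N by rewrite ltn_pmod.
have FE : ((k + 1) * j = F * q + rho)%N.
  rewrite (divn_eq ((k + 1) * j) q); congr (_ + _)%N; rewrite /rho.
  have -> : ((k + 1) * j = f * j * q + Mq k q * j)%N by rewrite {1}kE /Mq; lia.
  by rewrite modnMDl.
have rf : (rho * f + f <= f * q)%N by rewrite (mulnC rho) -mulnSr leq_mul2l rlt orbT.
have F1 : (0 < F)%N
  by rewrite divn_gt0 // (leq_trans _ (leq_pmulr _ _)); lia.
have Fk : (F <= k.+1)%N.
  by rewrite -(mulnK k.+1 q0) leq_div2r // addn1 leq_mul2l; lia.
have k2 : (k ^ 2 + k = k * k.+1)%N by rewrite -mulnn mulnS addnC.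
have k0 : (0 < k)%N by lia.
have jqk : (k.+1 * j <= k.+1 * q)%N by rewrite leq_mul2l; lia.
rewrite addn1 in FE; move: FE rf F1 Fk sm; move: (sq k q j) F rho rlt => s F rho rlt.
move=> FE rf F1 Fk sm; apply/andP; split.
  have kF : (k <= k * F)%N by rewrite leq_pmulr.
  case: (posnP rho) => r0; last first.
    have rf0 : (0 < rho * f)%N by rewrite muln_gt0 r0.
    by lia.
  have F2 : (1 < F)%N.
    rewrite ltnNge; apply/negP => F1'; have F1e : F = 1%N by lia.
    have : (k.+1 <= k.+1 * j)%N by rewrite leq_pmulr //; lia.
    by move: FE; rewrite r0 F1e; lia.
  have : (k * 2 <= k * F)%N by rewrite leq_mul2l F2 orbT.
  by lia.
rewrite k2 mulnS; have : (F <= k)%N \/ F = k.+1 by lia.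
case=> [Fk'|FE'].
  have : (k * F <= k * k)%N by rewrite leq_mul2l Fk' orbT.
  by lia.
have [r0 jE] : (rho = 0 /\ k.+1 * j = k.+1 * q)%N by move: FE; rewrite FE'; lia.
have jqE : j = q by apply/eqP; rewrite -(eqn_pmul2l (ltn0Sn k)); apply/eqP.
have q1 : q = 1%N by move: cjq; rewrite jqE /coprime gcdnn => /eqP.
have : mq k q = 0%N by lia.
by rewrite FE' r0; lia.
Qed.

Lemma cyc_inj (w r1 r2 : nat) : (1 <= w <= f)%N -> (r1 < q)%N -> (r2 < q)%N ->
  cyc k q j w r1 = cyc k q j w r2 -> r1 = r2.
Proof.
move=> hw l1 l2; have q0 : (0 < q)%N by lia.
rewrite (cycE k q j w r1 q0 cjq (ltnW l1)) (cycE k q j w r2 q0 cjq (ltnW l2)).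
move=> /(block_inj (fq k q) q j (mq k q) _ _ w w hw hw)[vE _].
exact: slot_inj cjq l1 l2 vE.
Qed.

Lemma cyc_disjoint (w1 w2 r1 r2 : nat) : (1 <= w1 <= f)%N -> (1 <= w2 <= f)%N ->
  (r1 < q)%N -> (r2 < q)%N ->
  cyc k q j w1 r1 = cyc k q j w2 r2 -> w1 = w2.
Proof.
move=> h1 h2 l1 l2; have q0 : (0 < q)%N by lia.
rewrite (cycE k q j w1 r1 q0 cjq (ltnW l1)) (cycE k q j w2 r2 q0 cjq (ltnW l2)).
by move=> /(block_inj (fq k q) q j (mq k q) _ _ w1 w2 h1 h2)[].
Qed.

(** The cycle [c_1] is the orbit of [k - 1], so it can be recovered from [eta] alone. *)
Lemma cyc_iter (n r : nat) :
  (n%:Z = eta %[mod (k ^ 2 + k)%N%:Z])%Z -> (r <= q)%N ->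
  ((gperm k n ^+ r)%g (penult k))%:Z = cyc k q j 1 r.
Proof.
move=> nE; have f0 := fq_gt0 k q hq; have q0 : (0 < q)%N by lia.
elim: r => [|r IH] rq; first by rewrite expg0 perm1 penultE /cyc /=; lia.
have := @cyc_range k q j 1 r.+1 q0 cjq rq; rewrite -/f f0 => /(_ isT) rng.
have lt : (`|cyc k q j 1 r.+1| < k.+1)%N by lia.
rewrite expgSr permM (@gperm_Gedge k n eta _ (Ordinal lt)) //=; first by lia.
rewrite (IH (ltnW rq)) -[eta]addr0 gez0_abs; last by lia.
by apply: cyc_Gedge => //; lia.
Qed.

End Peaks.

(** * Counting the up-steps *)

(** Equal values of [eta] share the cycle [c_1]. Its length gives [q]; the place [r] where it meets
    block [1] satisfies [r j = r j' = 1] modulo [q], which gives [j]. *)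
Lemma eta_inj (k q j q' j' : nat) :
  (1 <= q <= k)%N -> (1 <= j <= q)%N -> coprime j q ->
  (1 <= q' <= k)%N -> (1 <= j' <= q')%N -> coprime j' q' ->
  etaq k q j = etaq k q' j' -> q = q' /\ j = j'.
Proof.
move=> hq hj c hq' hj' c' E.
have k0 : (0 < k)%N by lia.
have [n nE _] := Nk_nat_rep k (etaq k q j) k0.
have nE' := nE; rewrite E in nE'.
have it := cyc_iter k q j hq hj c n; have it' := cyc_iter k q' j' hq' hj' c' n.
have same r : (r <= q)%N -> (r <= q')%N -> cyc k q j 1 r = cyc k q' j' 1 r.
  by move=> l l'; rewrite -it // -it'.
have f0 : (1 <= 1 <= fq k q)%N := fq_gt0 k q hq.
have f0' : (1 <= 1 <= fq k q')%N := fq_gt0 k q' hq'.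
have qq : q = q'.
  have no_lt p i p' i' : (1 <= p' <= k)%N -> (1 <= i' <= p')%N -> coprime i' p' -> (0 < p < p')%N ->
      (1 <= 1 <= fq k p')%N ->
      (forall r, (r <= p)%N -> cyc k p i 1 r = cyc k p' i' 1 r) -> False.
    move=> hp' hi' ci' /andP[p0 lt] ff H.
    have := cyc_inj k p' i' hp' hi' ci' 1 p 0 ff lt (leq_ltn_trans (leq0n _) lt).
    rewrite -H // -H // cyc_loop => /(_ erefl) p0'.
    by rewrite p0' in p0.
  case: (ltngtP q q') => // lt; exfalso.
    by apply: (no_lt q j q' j') => //; [lia | move=> r l; apply: same; lia].
  by apply: (no_lt q' j' q j) => //; [lia | move=> r l; symmetry; apply: same; lia].
split=> //; rewrite -qq in hj' c' same hq' f0'.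
have q0 : (0 < q)%N by lia.
have [r rq r1] := slot_eq1 q j hj c.
have := same r (ltnW rq) (ltnW rq).
rewrite (cycE k q j 1 r q0 c (ltnW rq)) (cycE k q j' 1 r q0 c' (ltnW rq)) r1.
rewrite below1 ?mq_lt // => e.
have r1' : slot q j' r = 1%N.
  have /andP[v0 _] := slot_bounds q j' r q0 c' (ltnW rq).
  case: (ltngtP (slot q j' r) 1) => // v1; first by lia.
  have : (fq k q * 2 <= fq k q * slot q j' r)%N by rewrite leq_mul2l v1 orbT.
  by lia.
apply: (@mod_rep_inj q) => //.
have E1 : r * j = 1 %[mod q] by rewrite -slot_mod r1.
have E2 : r * j' = 1 %[mod q] by rewrite -slot_mod r1'.
have L1 : j = j * (r * j') %[mod q] by rewrite -modnMmr E2 modnMmr muln1.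
have L2 : j' = j' * (r * j) %[mod q] by rewrite -modnMmr E1 modnMmr muln1.
by rewrite L1 L2 mulnCA (mulnCA j') (mulnC j).
Qed.

Definition peak_index (k q j : nat) : Prop :=
  [/\ (1 <= q <= k)%N, (1 <= j <= q)%N & coprime j q].

(** If [i < i'], then [i] steps to the right of the common point lies the first peak, where [N]
    falls, yet the second run is still rising there. *)
Lemma eta_runs_disjoint (k q j q' j' i i' : nat) :
  peak_index k q j -> peak_index k q' j' ->
  (1 <= i <= fq k q)%N -> (1 <= i' <= fq k q')%N ->
  (etaq k q j - i%:Z = etaq k q' j' - i'%:Z %[mod (k ^ 2 + k)%N%:Z])%Z -> i = i'.
Proof.
have main p a p' a' b b' : peak_index k p a -> peak_index k p' a' ->
    (1 <= b)%N -> (b' <= fq k p')%N ->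
    (etaq k p a - b%:Z = etaq k p' a' - b'%:Z %[mod (k ^ 2 + k)%N%:Z])%Z ->
    (b < b')%N -> False.
  move=> [hp ha c] [hp' ha' c'] b1 bf E lt.
  have := eta_down k p a hp ha c 0 (fq_gt0 k p hp).
  have blt : (b' - b - 1 < fq k p')%N by lia.
  have := eta_up k p' a' hp' ha' c' _ blt.
  have e0 := Nk_mod k _ _ b%:Z E; have e1 := Nk_mod k _ _ (b%:Z + 1) E.
  rewrite (_ : etaq k p' a' - (b' - b - 1)%N%:Z - 1 = etaq k p' a' - b'%:Z + b%:Z); last by lia.
  rewrite (_ : etaq k p' a' - (b' - b - 1)%N%:Z = etaq k p' a' - b'%:Z + (b%:Z + 1)); last by lia.
  have s0 : etaq k p a - b%:Z + b%:Z = etaq k p a by rewrite subrK.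
  have s1 : etaq k p a - b%:Z + (b%:Z + 1) = etaq k p a + 1 by rewrite addrA subrK.
  by rewrite -e0 -e1 s0 s1 addr0; clear; lia.
move=> h h' hi hi' E; case: (ltngtP i i') => // lt; exfalso.
  by apply: (main q j q' j' i i') => //; lia.
by apply: (main q' j' q j i' i) => //; lia.
Qed.

(** All steps are [+1] or [-1], and they sum to zero over a period. *)
Lemma card_up_steps (k : nat) : (0 < k)%N ->
  (#|[set n : 'I_(k ^ 2 + k) | (Nk n%:Z k < Nk (n%:Z + 1) k)%N]| * 2
   = k ^ 2 + k)%N.
Proof.
move=> k0; set L := (k ^ 2 + k)%N; set Up := [set _ | _].
have tele : \sum_(0 <= n < L) ((Nk (n.+1)%:Z k)%:Z - (Nk n%:Z k)%:Z) = 0.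
  rewrite (telescope_sumr (fun n : nat => (Nk n%:Z k)%:Z)) //.
  by rewrite (_ : Nk L%:Z k = Nk 0 k) ?subrr // /Nk modzz mod0z.
have : \sum_(n < L) ((n \in Up)%:R * 2 - 1 : int) = 0.
  rewrite -[RHS]tele big_mkord; apply: eq_bigr => n _; rewrite inE.
  have -> : n.+1%:Z = n%:Z + 1 by lia.
  by have := Nk_step k n%:Z k0; case: ltnP => /= h [] e; lia.
rewrite big_split /= sumrN -mulr_suml sumr_const card_ord.
have cardU : (\sum_(i < L) (i \in Up) = #|Up|)%N.
  by rewrite -sum1_card [RHS]big_mkcond; apply: eq_bigr => i _; case: ifP.
rewrite -natr_sum cardU.
by rewrite !natz; move: #|Up| {tele} cardU => u _; clearbody L; lia.
Qed.

Lemma up_steps_are_runs (k : nat) (x : int) : (0 < k)%N ->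
  (Nk x k < Nk (x + 1) k)%N ->
  exists q j i : nat, [/\ peak_index k q j, (1 <= i <= fq k q)%N &
    (x = etaq k q j - i%:Z %[mod (k ^ 2 + k)%N%:Z])%Z].
Proof.
move=> k0 upx; set L := (k ^ 2 + k)%N.
have L0 : (0 < L)%N by rewrite /L; lia.
have ltL (y : int) : (`|(y %% L%:Z)%Z| < L)%N.
  have := modz_ge0 y (d := L%:Z); have := ltz_pmod y (d := L%:Z); lia.
pose res_ord (y : int) : 'I_L := Ordinal (ltL y).
have res_ordE y : (res_ord y)%:Z = (y %% L%:Z)%Z.
  by rewrite /= gez0_abs // modz_ge0 //; lia.
set Up := [set n : 'I_L | (Nk n%:Z k < Nk (n%:Z + 1) k)%N].
have inUp y : (res_ord y \in Up) = (Nk y k < Nk (y + 1) k)%N.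
  have E : ((res_ord y)%:Z = y %[mod L%:Z])%Z by rewrite res_ordE modz_mod.
  by rewrite inE -[in LHS](addr0 (res_ord y)%:Z) -addrA add0r !(Nk_mod k _ _ _ E) addr0.
(* [T] encodes the pairs [1 <= A p <= B p <= k], both coordinates shifted by one; dividing by the
   gcd recovers [q] and [j], and the gcd itself is the position in the run. *)
pose T : finType := {b : 'I_k & 'I_b.+1}.
pose B (p : T) : nat := (tag p).+1; pose A (p : T) : nat := (tagged p).+1.
pose g p := gcdn (A p) (B p).
pose q p := (B p %/ g p)%N; pose j p := (A p %/ g p)%N.
have gq p : (q p * g p = B p)%N by rewrite divnK // dvdn_gcdr.
have gj p : (j p * g p = A p)%N by rewrite divnK // dvdn_gcdl.
have g0 p : (0 < g p)%N by rewrite gcdn_gt0.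
have AB p : (0 < A p <= B p)%N by rewrite /A /B ltnS; have := ltn_ord (tagged p); lia.
have Bk p : (B p <= k)%N := ltn_ord (tag p).
have etaP p : peak_index k (q p) (j p).
  split.
  - have := gq p; have := g0 p; have := AB p; have := Bk p; nia.
  - have := gq p; have := gj p; have := g0 p; have := AB p; nia.
  - by rewrite /coprime -(eqn_pmul2r (g0 p)) muln_gcdl gq gj mul1n.
have gf p : (1 <= g p <= fq k (q p))%N.
  rewrite g0 /= /fq leq_divRL; last by have [/andP[]] := etaP p.
  by rewrite mulnC gq.
pose F p := res_ord (etaq k (q p) (j p) - (g p)%:Z).
(* The position [g p] is recovered first; then the two peaks agree modulo the period, hence are
   equal by [eta_range]. *)
have Finj : injective F.
  move=> p p' /(congr1 (fun z : 'I_L => z%:Z)); rewrite !res_ordE => E.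
  have gE := eta_runs_disjoint k _ _ _ _ _ _ (etaP p) (etaP p') (gf p) (gf p') E.
  have {}E : etaq k (q p) (j p) = etaq k (q p') (j p').
    have [h1 h2 h3] := etaP p; have [h1' h2' h3'] := etaP p'.
    have /andP[r1 r2] := eta_range k _ _ h1 h2 h3.
    have /andP[r1' r2'] := eta_range k _ _ h1' h2' h3'.
    rewrite -(modz_small (_ : 0 <= etaq k (q p) (j p) < L%:Z)) ?(ltW r1) //.
    rewrite -(modz_small (_ : 0 <= etaq k (q p') (j p') < L%:Z)) ?(ltW r1') //.
    have := congr1 (fun z => ((z + (g p)%:Z) %% L%:Z)%Z) E.
    by rewrite /= !modzDml subrK gE subrK.
  have [h1 h2 h3] := etaP p; have [h1' h2' h3'] := etaP p'.
  have [qE jE] := eta_inj k _ _ _ _ h1 h2 h3 h1' h2' h3' E.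
  have BE : B p = B p' by rewrite -gq -(gq p') qE gE.
  have AE : A p = A p' by rewrite -gj -(gj p') jE gE.
  case: p p' BE AE {E gE qE jE h1 h2 h3 h1' h2' h3'} => [b a] [b' a'].
  rewrite /A /B /= => -[/ord_inj bE]; rewrite -bE in a' * => -[/ord_inj ->].
  by [].
have FUp p : F p \in Up.
  have [h1 h2 h3] := etaP p; have /andP[g1 gle] := gf p.
  have lt : ((g p).-1 < fq k (q p))%N by rewrite prednK.
  rewrite inUp; have := eta_up k _ _ h1 h2 h3 _ lt.
  have -> : etaq k (q p) (j p) - (g p).-1%:Z - 1 = etaq k (q p) (j p) - (g p)%:Z by lia.
  have -> : etaq k (q p) (j p) - (g p).-1%:Z = etaq k (q p) (j p) - (g p)%:Z + 1 by lia.
  by move=> ->.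
have cardT : (#|T| * 2 = L)%N.
  rewrite card_tagged sumnE big_map big_enum /=.
  under eq_bigr do rewrite card_ord.
  rewrite /L; clear; elim: k => [|k IH]; first by rewrite big_ord0.
  by rewrite big_ord_recr /= mulnDl IH; lia.
(* An injection between sets of equal cardinality is onto, so no other up-step exists. *)
have FT : F @: setT = Up.
  apply/eqP; rewrite eqEcard; apply/andP; split.
    by apply/subsetP => _ /imsetP[p _ ->].
  rewrite card_imset // cardsT.
  by have := card_up_steps k k0; rewrite -/L -/Up; lia.
have : res_ord x \in Up by rewrite inUp.
rewrite -FT => /imsetP[p _ /(congr1 (fun z : 'I_L => z%:Z))]; rewrite !res_ordE => E.
by exists (q p), (j p), (g p).
Qed.

(** * Heights and completeness of the peaks *)

Lemma eta_mod_inj (k q j : nat) (x : int) : peak_index k q j ->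
  0 < x < (k ^ 2 + k)%N%:Z -> (x = etaq k q j %[mod (k ^ 2 + k)%N%:Z])%Z ->
  x = etaq k q j.
Proof.
move=> [hq hj c] /andP[x0 xL] E; have /andP[e0 eL] := eta_range k q j hq hj c.
rewrite -(modz_small (_ : 0 <= x < (k ^ 2 + k)%N%:Z)) ?(ltW x0) // E.
by rewrite modz_small // (ltW e0).
Qed.

(** The point lies on the graph of a tent of height [f] over some peak, at horizontal distance
    [i]. *)
Definition on_tent (k : nat) (x : int) : Prop :=
  exists q j i : nat, [/\ peak_index k q j, (Nk x k + i = fq k q)%N &
    (x = etaq k q j - i%:Z %[mod (k ^ 2 + k)%N%:Z])%Z \/
    (x = etaq k q j + i%:Z %[mod (k ^ 2 + k)%N%:Z])%Z].

Lemma modz_add1 (d x y : int) : (x = y %[mod d])%Z -> (x + 1 = y + 1 %[mod d])%Z.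
Proof. by move=> E; rewrite -modzDml E modzDml. Qed.

Lemma on_tentS (k : nat) (x : int) : (0 < k)%N -> on_tent k x -> on_tent k (x + 1).
Proof.
move=> k0 [q [j [i [h Ni E]]]]; have [hq hj c] := h.
(* At [i = 0] the two sides meet; the peak itself is treated as descending. *)
have {E}[[i0 E]|E] :
    ((0 < i)%N /\ (x = etaq k q j - i%:Z %[mod (k ^ 2 + k)%N%:Z])%Z) \/
    (x = etaq k q j + i%:Z %[mod (k ^ 2 + k)%N%:Z])%Z.
- case: (posnP i) => [i0|i0]; last by case: E; [left|right].
  by right; case: E; rewrite i0 ?subr0 ?addr0.
- have lt : (i.-1 < fq k q)%N by rewrite -Ni prednK // leq_addl.
  have := eta_up k q j hq hj c _ lt; have E1 := modz_add1 _ _ _ E.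
  have e0 : etaq k q j - i.-1%:Z - 1 = etaq k q j - i%:Z by clear -i0; lia.
  have e1 : etaq k q j - i.-1%:Z = etaq k q j - i%:Z + 1 by clear -i0; lia.
  rewrite e0 e1 -(Nk_congr k _ _ E) -(Nk_congr k _ _ E1) => S.
  exists q, j, i.-1; split=> //; first by rewrite -Ni S; clear -i0; lia.
  by left; rewrite e1.
have E1 := modz_add1 _ _ _ E.
case: (ltnP i (fq k q)) => ilt.
  have := eta_down k q j hq hj c _ ilt.
  rewrite -(Nk_congr k _ _ E) -(Nk_congr k _ _ E1) => S.
  exists q, j, i.+1; split=> //; first by rewrite -Ni S addnS.
  by right; rewrite (_ : i.+1%:Z = i%:Z + 1) ?addrA //; clear; lia.
(* At the foot of a tent [N] is zero, so the next step goes up and belongs to some run. *)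
have N0 : Nk x k = 0%N by clear -Ni ilt; lia.
have [N1|] := Nk_step k x k0; last by rewrite N0.
have [|q' [j' [i' [h' hi' E']]]] := up_steps_are_runs k x k0; first by rewrite N1.
have [hq' hj' c'] := h'; have /andP[i1' ile'] := hi'.
(* Were [x] not the start of that run, the step into [x] would also go up, against [N = 0]. *)
have iE : i' = fq k q'.
  apply/eqP; rewrite eqn_leq ile' /= leqNgt; apply/negP => lt.
  by have := eta_up k q' j' hq' hj' c' _ lt; rewrite -(Nk_congr k _ _ E') N0.
exists q', j', i'.-1; split=> //; first by rewrite N1 N0 add1n prednK.
left; have -> : etaq k q' j' - i'.-1%:Z = etaq k q' j' - i'%:Z + 1.
  by clear -i1'; lia.
exact: modz_add1.
Qed.

Lemma eta_ge (k q j i : nat) : peak_index k q j -> (i <= fq k q)%N ->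
  (Nk (etaq k q j + i%:Z) k + i = Nk (etaq k q j) k)%N.
Proof.
move=> [hq hj c]; elim: i => [|i IH] ilt; first by rewrite addn0 addr0.
rewrite -(IH (ltnW ilt)) (eta_down k q j hq hj c i ilt).
by rewrite (_ : i.+1%:Z = i%:Z + 1) ?addrA ?addnS //; lia.
Qed.

(** At [eta(1,1)] the [k] descents and the bound [N <= k] give height [k]. Following tents from
    there reaches [eta(q,j)] modulo the period; being a peak, it can only be the top of its tent. *)
Lemma Nk_eta (k q j : nat) : peak_index k q j -> Nk (etaq k q j) k = fq k q.
Proof.
move=> h; have [hq hj c] := h; have k0 : (0 < k)%N by lia.
have h1 : peak_index k 1 1 by split => //; rewrite k0.
have tent n : on_tent k (etaq k 1 1 + n%:Z).
  elim: n => [|n IH]; last first.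
    rewrite (_ : n.+1%:Z = n%:Z + 1) ?addrA; last by lia.
    exact: on_tentS.
  exists 1%N, 1%N, 0%N; split => //; last by right.
  have := eta_ge k 1 1 (fq k 1) h1 (leqnn _); have := Nk_le k (etaq k 1 1) k0.
  by rewrite addr0 addn0 /fq divn1; lia.
have /andP[e0 eL] := eta_range k q j hq hj c.
have [hq1 hj1 c1] := h1; have /andP[e0' eL'] := eta_range k 1 1 hq1 hj1 c1.
(* A period is added to make the distance from [eta(1,1)] nonnegative. *)
have := tent (absz (etaq k q j + (k ^ 2 + k)%N%:Z - etaq k 1 1)%R).
rewrite gez0_abs; last by rewrite subr_ge0 ltW // (lt_le_trans eL') // lerDr ltW.
rewrite addrC subrK => -[q' [j' [i [h' Ni E]]]].
have [hq' hj' c'] := h'.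
have mE : (etaq k q j + (k ^ 2 + k)%N%:Z = etaq k q j %[mod (k ^ 2 + k)%N%:Z])%Z.
  by rewrite modzDr.
rewrite mE in E; rewrite (Nk_congr k _ _ mE) in Ni.
case: (posnP i) => i0.
  have {}E : (etaq k q j = etaq k q' j' %[mod (k ^ 2 + k)%N%:Z])%Z.
    by case: E; rewrite i0 ?subr0 ?addr0.
  have r : 0 < etaq k q j < (k ^ 2 + k)%N%:Z by rewrite e0.
  have [qE _] := eta_inj k q j q' j' hq hj c hq' hj' c' (eta_mod_inj k q' j' _ h' r E).
  by move: Ni; rewrite i0 addn0 qE.
have lt : (i.-1 < fq k q')%N by rewrite -Ni prednK // leq_addl.
have dn := eta_down k q j hq hj c 0 (fq_gt0 k q hq).
have up := eta_up k q j hq hj c 0 (fq_gt0 k q hq).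
rewrite addr0 in dn; rewrite subr0 in up.
case: E => E; exfalso.
  have := eta_up k q' j' hq' hj' c' _ lt.
  have -> : etaq k q' j' - i.-1%:Z - 1 = etaq k q' j' - i%:Z by clear -i0; lia.
  have -> : etaq k q' j' - i.-1%:Z = etaq k q' j' - i%:Z + 1 by clear -i0; lia.
  rewrite -(Nk_congr k _ _ E) -(Nk_mod k _ _ 1 E).
  by clear -dn; lia.
have := eta_down k q' j' hq' hj' c' _ lt.
have -> : etaq k q' j' + i.-1%:Z + 1 = etaq k q' j' + i%:Z by clear -i0; lia.
have -> : etaq k q' j' + i.-1%:Z = etaq k q' j' + i%:Z - 1 by clear -i0; lia.
rewrite -(Nk_congr k _ _ E) -(Nk_mod k _ _ (-1) E).
by clear -up; lia.
Qed.

Lemma eta_peak (k q j : nat) : peak_index k q j -> local_peak k (etaq k q j).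
Proof.
move=> [hq hj c]; split; first exact: eta_range.
have dn := eta_down k q j hq hj c 0 (fq_gt0 k q hq).
have up := eta_up k q j hq hj c 0 (fq_gt0 k q hq).
by rewrite addr0 in dn; rewrite subr0 in up; rewrite {1}up {1}dn !ltnSn.
Qed.

(** The step into a peak lies on some run. If it were not the last step of that run, the next step
    would rise too. *)
Lemma peak_eta (k : nat) (x : int) : (0 < k)%N -> local_peak k x ->
  exists q j, peak_index k q j /\ x = etaq k q j.
Proof.
move=> k0 [xr [lo hi]].
have [|q [j [i [h hi' E]]]] := up_steps_are_runs k (x - 1) k0; first by rewrite subrK.
have [hq hj c] := h; exists q, j; split=> //; apply: eta_mod_inj => //.
have E1 := modz_add1 _ _ _ E; rewrite subrK in E1.
have [i1|i2] : i = 1%N \/ (1 < i)%N by lia.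
  by rewrite E1 i1 subrK.
have lt : (i - 2 < fq k q)%N by clear -hi' i2; lia.
exfalso; have := eta_up k q j hq hj c _ lt.
have -> : etaq k q j - (i - 2)%N%:Z - 1 = etaq k q j - i%:Z + 1 by clear -i2; lia.
have -> : etaq k q j - (i - 2)%N%:Z = etaq k q j - i%:Z + 1 + 1 by clear -i2; lia.
rewrite -(Nk_congr k _ _ E1) -(Nk_mod k _ _ 1 E1).
by clear -hi; lia.
Qed.

Theorem theorem7p5 (k : nat) (hk : (1 <= k)%N) :
  (forall q j : nat, (1 <= q <= k)%N -> (1 <= j <= q)%N -> coprime j q ->
    (* each c_w is a cycle of length q in G(eta(q,j),k) *)
    (forall w : nat, (1 <= w <= fq k q)%N ->
       (forall r : nat, (r < q)%N ->
          Gedge (etaq k q j) k (cyc k q j w r) (cyc k q j w r.+1)) /\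
       cyc k q j w q = cyc k q j w 0 /\
       (forall r1 r2 : nat, (r1 < q)%N -> (r2 < q)%N ->
          cyc k q j w r1 = cyc k q j w r2 -> r1 = r2)) /\
    (* the f cycles are pairwise distinct (not rotations of each other) *)
    (forall w1 w2 : nat, (1 <= w1 <= fq k q)%N -> (1 <= w2 <= fq k q)%N ->
       w1 <> w2 ->
       ~ (exists sh : nat, forall r : nat, (r < q)%N ->
            cyc k q j w1 r = cyc k q j w2 ((r + sh) %% q)%N)) /\
    Nk (etaq k q j) k = fq k q /\
    local_peak k (etaq k q j)) /\
  (forall n : int, local_peak k n <->
     exists q j : nat, [/\ (1 <= q <= k)%N, (1 <= j <= q)%N, coprime j q &
                          n = etaq k q j]) /\
  (forall (n : int) (v : nat), (local_peak k n /\ v = Nk n k) <->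
     exists q j : nat, [/\ (1 <= q <= k)%N, (1 <= j <= q)%N, coprime j q,
                          n = etaq k q j & v = (k %/ q)%N]).
Proof.
split=> [q j hq hj c|]; last split=> [n|n v]; last 1 first.
- split=> [[/(peak_eta k n hk)[q [j [h ->]]] ->]|[q [j [hq hj c -> ->]]]].
    by have [hq hj c] := h; exists q, j; rewrite (Nk_eta k q j h).
  have h : peak_index k q j by split.
  by rewrite (Nk_eta k q j h); split => //; apply: eta_peak.
- have h : peak_index k q j by split.
  have q0 : (0 < q)%N by lia.
  split=> [w hw|].
    split=> [r rq|]; last by split; [exact: cyc_loop | move=> r1 r2; apply: cyc_inj].
    by rewrite -[etaq k q j]addr0; apply: cyc_Gedge => //; lia.
  split=> [w1 w2 h1 h2 ne [sh H]|]; last by split; [exact: Nk_eta | exact: eta_peak].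
  (* Distinct cycles share no vertex, so comparing the two at [r = 0] already rules out a
     rotation. *)
  apply: ne; apply: (cyc_disjoint k q j hq hj c w1 w2 0 ((0 + sh) %% q)) => //.
    by rewrite ltn_pmod.
  exact: H.
split=> [/(peak_eta k n hk)[q [j [[hq hj c] ->]]]|[q [j [hq hj c ->]]]].
  by exists q, j.
by apply: eta_peak; split.
Qed.
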